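(* Let $G/K$ be a compact symmetric space and let $\omega_{\tau}$ be a spherical function of $G/K$ which is not real valued. Fix an element $\alpha\in G$, $\alpha \notin K$, such that $K \alpha K = K\alpha^{-1}K$, set $a=1-\omega_{\tau}(\alpha)$, and assume $a\neq 0$. Let $W = \sqrt{\frac{\dim(\tau)}{2}} \left(\omega_{\tau}(g)+ \overline{\omega_{\tau}(g)} \right)$, where $gK$ is chosen from the $G$-invariant probability measure on $G/K$. Then for all real $x_0$, $$\left| \mathbb{P}(W \leq x_0) - \frac{1}{\sqrt{2 \pi}} \int_{-\infty}^{x_0}e^{-\frac{x^2}{2}}\, dx \right| \leq \frac{1}{2} \sqrt{\sum_{\phi\neq 1} m_{\phi}[(\tau+\overline{\tau})^2]^2 \left[ 2 - \frac{1}{a} \left( 1-\omega_{\phi}(\alpha) \right) \right]^2} + \left[ \frac{1}{\pi} \sum_{\phi}m_{\phi}[(\tau+\overline{\tau})^2]^2 \left(2 - \frac{3}{2a} \left(1-\omega_{\phi}(\alpha) \right) \right) \right]^{1/4},$$ where the first sum is over all non-trivial spherical functions $\omega_\phi$ of $G/K$, and the second sum is over all spherical functions $\omega_\phi$ of $G/K$.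
   Context: A Riemannian manifold $X$ is a symmetric space if the geodesic symmetry centered at any point is an isometry; then $X$ is identified with $G/K$, where $G$ is a connected transitive Lie group of isometries of $X$ and $K$ is a compact group which up to finite index is the stabilizer $\{g\in G: gx_0=x_0\}$ of a point $x_0$. Haar measures on compact groups are probability measures; the ''Haar measure'' $\mu$ on $G/K$ is the unique $G$-invariant measure with $\int_G f(g)\,dg=\int_{G/K}\left(\int_K f(gk)\,dk\right)\mu(d\,gK)$. A function $\omega_\phi\in L^2(G/K)$ is spherical if $\omega_\phi(1)=1$ and $\int_K \omega_{\phi}(xky)\, dk = \omega_{\phi}(x) \omega_{\phi}(y)$ for all $x,y\in G$; such functions are $K$-bi-invariant, so one writes $\omega_\phi(g)$ for $\omega_\phi(gK)$. The trivial spherical function is the constant $1$. For $G/K$ compact, the $G$-invariant subspace $H_\phi$ of $L^2(G/K)$ generated by $\omega_\phi$ is a finite-dimensional irreducible representation of $G$, and $L^2(G/K)$ is the direct sum of all such $H_\phi$; put $\dim(\phi)=\dim H_\phi$. The ''multiplicities'' $m_{\phi}[(\tau+\overline{\tau})^r]$ (non-negative reals, not necessarily integers) are defined by the expansion $(\omega_{\tau}+\overline{\omega_{\tau}})^r = \sum_{\phi} \left[\frac{\dim(\phi)}{\dim(\tau)^r} \right]^{1/2}m_{\phi}[(\tau+\overline{\tau})^r]\, \omega_{\phi}$; equivalently $m_{\phi}[(\tau+\overline{\tau})^r] = [\dim(\phi) \dim(\tau)^r]^{1/2}\int_{G/K} \left( \omega_{\tau}(g)+\overline{\omega_{\tau}(g)}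 \right)^r\overline{\omega_{\phi}(g)}$. Since $K\alpha K=K\alpha^{-1}K$, all $\omega_\phi(\alpha)$ are real. *)

(* Defs.v *)
From HB Require Import structures.
From mathcomp Require Import all_boot all_order all_algebra.
From mathcomp Require Import all_classical all_reals all_analysis.
From mathcomp Require Export complex.

Set Implicit Arguments.
Unset Strict Implicit.
Unset Printing Implicit Defensive.

Import Order.TTheory GRing.Theory Num.Theory.
Import numFieldNormedType.Exports.

Local Open Scope classical_set_scope.
Local Open Scope complex_scope.
Local Open Scope ring_scope.

(* The point supplied by [PointedTopological] carries no information: the
   library only builds Borel sigma-algebras on pointed types. *)
HB.mixin Record isTopologicalGroup G of Group G & PointedTopological G := {
  mulg_continuous : continuous (fun z : G * G => (z.1 * z.2)%g);
  invg_continuous : continuous (fun x : G => (x^-1)%g)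
}.

#[short(type="topologicalGroupType")]
HB.structure Definition TopologicalGroup :=
  {G of Group G & PointedTopological G & isTopologicalGroup G}.

Section smooth_manifolds.
Context {R : realType}.

Definition partial n (i : 'I_n) (f : 'rV[R]_n -> R) : 'rV[R]_n -> R :=
  'D_(delta_mx 0 i) f.

(* Meant for U open: partial derivatives of every order up to k exist and are
   continuous on U. *)
Fixpoint Ck (k n : nat) (U : set 'rV[R]_n) (f : 'rV[R]_n -> R) : Prop :=
  if k is k'.+1 then
    [/\ forall u, U u -> {for u, continuous f},
        forall u i, U u -> derivable f u (delta_mx 0 i)
      & forall i, Ck k' U (partial i f)]
  else forall u, U u -> {for u, continuous f}.

Definition smooth_on n (U : set 'rV[R]_n) (f : 'rV[R]_n -> R) :=
  forall k, Ck k U f.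

Record chart (X : topologicalType) (n : nat) := Chart {
  dom : set X ;
  coord : X -> 'rV[R]_n ;
  param : 'rV[R]_n -> X
}.

Definition img X n (c : chart X n) := coord c @` dom c.

(* [coord c] is a homeomorphism of an open subset of X onto an open subset of
   R^n, with inverse [param c]; both are unconstrained elsewhere. *)
Definition is_chart X n (c : chart X n) :=
  [/\ open (dom c) /\ open (img c),
      forall x, dom c x -> param c (coord c x) = x,
      forall x, dom c x -> {for x, continuous (coord c)}
    & forall u, img c u -> {for u, continuous (param c)}].

Definition local_dom X Y n m (c : chart X n) (d : chart Y m) (f : X -> Y) :=
  [set u | img c u /\ dom d (f (param c u))].

Definition local_rep X Y n m (c : chart X n) (d : chart Y m) (f : X -> Y) :=
  fun u => coord d (f (param c u)).

Definition smooth_map X Y n m (A : set (chart X n)) (B : set (chart Y m))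
    (f : X -> Y) :=
  continuous f /\
  forall c d, A c -> B d -> forall j : 'I_m,
    smooth_on (local_dom c d f) (fun u => local_rep c d f u 0 j).

(* [smooth_map A A idfun] is the smoothness of the transition functions. *)
Definition manifold (X : topologicalType) n (A : set (chart X n)) :=
  [/\ hausdorff_space X, @second_countable X,
      forall c, A c -> is_chart c,
      forall x, exists2 c, A c & dom c x
    & smooth_map A A idfun].

Definition prod_chart X Y n m (c : chart X n) (d : chart Y m) :
    chart (X * Y)%type (n + m) :=
  Chart (dom c `*` dom d)
        (fun p => row_mx (coord c p.1) (coord d p.2))
        (fun w => (param c (lsubmx w), param d (rsubmx w))).

Definition prod_atlas X Y n m (A : set (chart X n)) (B : set (chart Y m)) :=
  [set e | exists c d, [/\ A c, B d & e = prod_chart c d]].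

End smooth_manifolds.

Arguments chart : clear implicits.

Section riemannian_geometry.
Context {R : realType} (X : topologicalType) (n : nat).

(* [g c u] is the Gram matrix, in the coordinates c, of the inner product on
   the tangent space at [param c u]. *)
Variables (A : set (chart R X n)) (g : chart R X n -> 'rV[R]_n -> 'M[R]_n).

(* With row vectors, the differential of a map h at u sends v to v *m 'J h u. *)
Definition preserves_metric (f : X -> X) :=
  forall c d u, A c -> A d -> local_dom c d f u ->
    let J := 'J (local_rep c d f) u in
    g c u = J *m g d (local_rep c d f u) *m J^T.

(* [preserves_metric idfun] says that g transforms as a tensor under changes
   of coordinates. *)
Definition riemannian_metric :=
  [/\ forall c i j, A c -> smooth_on (img c) (fun u => g c u i j),
      forall c u, A c -> img c u -> (g c u)^T = g c u,
      forall c u, A c -> img c u ->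
        forall v : 'rV[R]_n, v != 0 -> 0 < (v *m g c u *m v^T) 0 0
    & preserves_metric idfun].

Definition isometry (f : X -> X) := exists h : X -> X,
  [/\ cancel f h, cancel h f, smooth_map A A f, smooth_map A A h
    & preserves_metric f].

Definition christoffel (c : chart R X n) (u : 'rV[R]_n) (i j k : 'I_n) : R :=
  2^-1 * \sum_(l < n) invmx (g c u) k l *
    (partial i (fun w => g c w j l) u + partial j (fun w => g c w i l) u
     - partial l (fun w => g c w i j) u).

(* Affinely parametrized geodesics (constant ones included) on ]-e, e[. *)
Definition geodesic (e : R) (gamma : R -> X) :=
  forall t : R, `|t| < e -> {for t, continuous gamma} /\
    forall c, A c -> dom c (gamma t) ->
      let x (i : 'I_n) (s : R) : R := coord c (gamma s) 0 i in
      forall k, [/\ derivable (x k) t 1, derivable (derive1 (x k)) t 1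
        & derive1 (derive1 (x k)) t + \sum_(i < n) \sum_(j < n)
            christoffel c (coord c (gamma t)) i j k
            * (derive1 (x i) t * derive1 (x j) t) = 0].

(* The geodesic symmetry at p, which reverses the geodesics through p, is
   (the germ of) an isometry of the whole space. *)
Definition symmetric_manifold :=
  [/\ manifold A, riemannian_metric
    & forall p, exists2 s, isometry s &
        forall (e : R) gamma, geodesic e gamma -> gamma 0 = p ->
          forall t : R, `|t| < e -> s (gamma t) = gamma (- t)].

End riemannian_geometry.

Section symmetric_spaces.
Context {R : realType}.

Definition lie_group (G : topologicalGroupType) m (A : set (chart R G m)) :=
  [/\ manifold A,
      smooth_map (prod_atlas A A) A (fun p : G * G => (p.1 * p.2)%g)
    & smooth_map A A (fun x : G => (x^-1)%g)].

Definition subgroup (G : groupType) (H : set G) :=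
  H 1%g /\ forall x y, H x -> H y -> H (x * y^-1)%g.

Definition finite_index (G : groupType) (H' H : set G) :=
  exists2 F : set G, finite_set F &
    forall x, H x -> exists2 y, F y & H' (y^-1 * x)%g.

(* A presentation of a compact symmetric space as G/K.  The action of G on X
   by isometries need not be effective, and K agrees with the stabilizer of
   the base point up to finite index (in either direction).  Since K is
   compact, G/K is compact if and only if G is. *)
Record compact_symmetric_space (G : topologicalGroupType) (K : set G) := {
  css_dim : nat ;
  css_space : topologicalType ;
  css_atlas : set (chart R css_space css_dim) ;
  css_metric : chart R css_space css_dim -> 'rV[R]_css_dim -> 'M[R]_css_dim ;
  css_symmetric : symmetric_manifold css_atlas css_metric ;
  css_group_dim : nat ;
  css_group_atlas : set (chart R G css_group_dim) ;
  css_lie : lie_group css_group_atlas ;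
  css_connected : connected [set: G] ;
  css_compact : compact [set: G] ;
  css_act : G -> css_space -> css_space ;
  css_act1 : forall x, css_act 1%g x = x ;
  css_actM : forall a b x, css_act (a * b)%g x = css_act a (css_act b x) ;
  css_act_smooth : smooth_map (prod_atlas css_group_atlas css_atlas) css_atlas
    (fun p => css_act p.1 p.2) ;
  css_act_isometry : forall a, isometry css_atlas css_metric (css_act a) ;
  css_act_transitive : forall x y, exists a, css_act a x = y ;
  css_base : css_space ;
  css_K_subgroup : subgroup K ;
  css_K_compact : compact K ;
  css_K_stabilizer :
    let H := [set a | css_act a css_base = css_base] in
    finite_index (K `&` H) K /\ finite_index (K `&` H) H
}.

End symmetric_spaces.

Arguments compact_symmetric_space R {G} K.

Definition borel (G : topologicalGroupType) := g_sigma_algebraType (@open G).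

(* mu is the normalized Haar measure of the compact subgroup H, viewed as a
   measure on G carried by H. *)
Definition haar_on (R : realType) (G : topologicalGroupType) (H : set G)
    (mu : probability (borel G) R) :=
  (mu H = 1)%E /\
  forall (a : G) (A : set (borel G)), H a -> measurable A ->
    mu ((fun x : G => (a * x)%g) @^-1` A) = mu A.

Definition Cintegral (R : realType) (G : topologicalGroupType)
    (mu : probability (borel G) R) (D : set G) (f : G -> R[i]) : R[i] :=
  (\int[mu]_(x in D) complex.Re (f x)) +i* (\int[mu]_(x in D) complex.Im (f x)).

(* Functions on G/K are represented by right K-invariant functions on G; by
   the defining relation of the invariant measure on G/K, the integral over
   G/K of such a function is its Haar integral over G. *)
Section spherical_functions.
Context {R : realType} {G : topologicalGroupType}.
Variables (mu nu : probability (borel G) R) (K : set G).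

Definition L2 (f : G -> R[i]) :=
  [/\ measurable_fun [set: borel G] (fun x : borel G => complex.Re (f x)),
      measurable_fun [set: borel G] (fun x : borel G => complex.Im (f x)),
      forall x k, K k -> f (x * k)%g = f x
    & (\int[mu]_x ((Normc.normc (f x) ^+ 2)%:E) < +oo)%E].

(* Point evaluations only make sense for a definite representative of a class
   in L^2(G/K): the continuous one. *)
Definition spherical (omega : G -> R[i]) :=
  [/\ L2 omega,
      continuous (fun x => complex.Re (omega x)) /\
      continuous (fun x => complex.Im (omega x)),
      omega 1%g = 1
    & forall x y,
        Cintegral nu K (fun k => omega (x * k * y)%g) = omega x * omega y].

(* The G-invariant subspace generated by omega. *)
Definition Hspace (omega : G -> R[i]) : set (G -> R[i]) :=
  [set f | exists m (c : 'I_m -> R[i]) (h : 'I_m -> G),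
     f = fun x => \sum_(i < m) c i * omega ((h i)^-1 * x)%g].

Definition has_dim (V : set (G -> R[i])) (m : nat) :=
  exists b : 'I_m -> G -> R[i],
  [/\ forall i, V (b i),
      forall c : 'I_m -> R[i],
        (forall x, \sum_(i < m) c i * b i x = 0) -> forall i, c i = 0
    & forall f, V f ->
        exists c : 'I_m -> R[i], f = fun x => \sum_(i < m) c i * b i x].

Definition dimH (omega : G -> R[i]) : nat :=
  xget 0%N [set m | has_dim (Hspace omega) m].

(* L^2(G/K) is the (Hilbert) sum of the H_phi, i.e. their algebraic sum is
   dense.  That the sum is direct and orthogonal is a consequence of the
   functional equation and need not be required. *)
Definition L2_sum_of_Hspaces :=
  forall f, L2 f -> forall e : R, 0 < e ->
  exists m (phi h : 'I_m -> G -> R[i]),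
    (forall i, spherical (phi i) /\ Hspace (phi i) (h i)) /\
    (\int[mu]_x ((Normc.normc (f x - \sum_(i < m) h i x) ^+ 2)%:E) < e%:E)%E.

(* m_phi[(tau + tau-bar)^r].  The integral is real. *)
Definition multiplicity (r : nat) (tau phi : G -> R[i]) : R :=
  Num.sqrt ((dimH phi)%:R * (dimH tau)%:R ^+ r) *
  complex.Re (Cintegral mu setT
    (fun g => (tau g + (tau g)^*) ^+ r * (phi g)^*)).

End spherical_functions.

Definition double_coset (G : groupType) (K : set G) (a : G) : set G :=
  [set x | exists k l, [/\ K k, K l & x = (k * a * l)%g]].

(* Main.v *)
(* The pair (W(g), W(g alpha)) with g Haar distributed is exchangeable, because
   K alpha K is symmetric and Haar measure is bi-invariant, and averaging over K
   gives E[phi(g alpha) | g] = phi(alpha) phi(g) for every spherical phi.  Hence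
   E[W(g alpha) | g] = (1 - a) W(g), and expanding W^2 in spherical functions
   expresses Var E[(W(g alpha) - W(g))^2 | g] and E (W(g alpha) - W(g))^4 through
   the multiplicities.  These are fed to Stein's normal approximation bound.

   The spectral input is elementary.  The reproducing property of a spherical
   phi on the space H spanned by its translates bounds, through the trace of
   the projection kernel, the size of an independent family in H by
   1 / |phi|^2, with equality for a basis; so dim H = 1 / |phi|^2.  Since
   (tau + conj tau)^2 (zy) is then a finite sum of products c(z) v(y), only
   finitely many phi occur in its expansion.

   Stein's bound smooths the indicator of ]-oo, x0] by a linear ramp, a
   difference of two hinges max(z - w, 0), for which the solution of Stein's
   equation is explicit in terms of the Mills ratio. *)
From HB Require Import structures.
Require Import Defs.
From mathcomp Require Import all_boot all_order all_algebra.
From mathcomp Require Import all_classical all_reals all_analysis.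
From mathcomp Require Import finmap measurable_realfun ring lra.

Set Implicit Arguments.
Unset Strict Implicit.
Unset Printing Implicit Defensive.

Import Order.TTheory GRing.Theory Num.Theory.
Import numFieldNormedType.Exports.

Local Open Scope classical_set_scope.
Local Open Scope complex_scope.
Local Open Scope ring_scope.

(** * Stein's equation for the normal law *)

(** No conditional expectation is formed: [regression] and [conditional_square] are identities
    tested against continuous functions of [W], which is all that Stein's argument consumes. The
    functions on the compact group are continuous, so they stay in the class [bmf], where
    integrability is automatic. Density of the [Hspace]s is an L^2 statement, but pointwise
    expansions are needed. Once finitely many coefficients remain, the difference between function
    and sum is continuous and orthogonal to every spherical function, hence identically zero.
    Constants: a ramp of width [e] costs [V + B3 / (2 a e)] through Stein's equation and
    [e / (2 sqrt (2 pi))] through smoothing; the best [e] leaves [V] plus a multiple of [sqrt B3].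
    Cauchy-Schwarz bounds [B3 ^+ 2] by the second moment [2 a] of the increment times its fourth
    moment, so the last term is a fourth root, with constant [1 / pi]. A non-real [tau] is
    orthogonal to its conjugate, which gives [W] second moment 1. *)

Section derive_rules.
Context {R : realType}.
Implicit Types (f g : R -> R) (x a b k : R).

Lemma is_deriveDf f g x a b : is_derive x 1 f a -> is_derive x 1 g b ->
  is_derive x 1 (fun t => f t + g t) (a + b).
Proof. by move=> fa gb; exact: is_deriveD. Qed.

Lemma is_deriveMf f g x a b : is_derive x 1 f a -> is_derive x 1 g b ->
  is_derive x 1 (fun t => f t * g t) (a * g x + f x * b).
Proof.
move=> fa gb; have := is_deriveM fa gb.
by rewrite /GRing.scale/= addrC [a * _]mulrC.
Qed.

Lemma is_deriveMl f x a k : is_derive x 1 f a ->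
  is_derive x 1 (fun t => k * f t) (k * a).
Proof. by move=> fa; exact: (is_deriveZ k fa). Qed.

Lemma is_deriveNf f x a : is_derive x 1 f a ->
  is_derive x 1 (fun t => - f t) (- a).
Proof. by move=> fa; exact: is_deriveN. Qed.

Lemma is_derive_oppr f x a : is_derive (- x) 1 f a ->
  is_derive x 1 (fun t => f (- t)) (- a).
Proof.
move=> fa; have := @is_derive1_comp _ f -%R x a (-1) fa (is_deriveNid _ _).
by rewrite mulrN1.
Qed.

Lemma is_derive_cont f x a : is_derive x 1 f a -> {for x, continuous f}.
Proof. by move=> [? _]; exact/differentiable_continuous/derivable1_diffP. Qed.

Lemma is_derive_nondecreasing f df x y : x <= y ->
  (forall t, x <= t <= y -> is_derive t 1 f (df t)) ->
  (forall t, x <= t <= y -> 0 <= df t) -> f x <= f y.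
Proof.
move=> xy fdf df0; have [| |c] := @MVT_segment _ f df x y xy.
- by move=> t; rewrite in_itv/= => /andP[/ltW ? /ltW ?]; apply/fdf/andP.
- apply/continuous_in_subspaceT => t /set_mem; rewrite /= in_itv/= => txy.
  exact: is_derive_cont (fdf _ txy).
- by rewrite in_itv/= => cxy fxy; rewrite -subr_ge0 fxy mulr_ge0 ?df0// subr_ge0.
Qed.

End derive_rules.

(** * The standard normal density and its distribution function *)

Section gaussian.
Context {R : realType}.
Implicit Types x w z : R.

Definition gauss_pdf (x : R) : R := (Num.sqrt (2 * pi))^-1 * expR (- (x ^+ 2 / 2)).

Definition gauss_cdf (x : R) : R :=
  \int[lebesgue_measure]_(t in `]-oo, x]) gauss_pdf t.

Lemma gauss_pdfE : gauss_pdf = normal_pdf 0 1.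
Proof.
apply/funext => x; rewrite normal_pdfE ?oner_neq0// /gauss_pdf.
by rewrite /normal_fun /normal_peak subr0 expr1n mul1r mulNr -[pi *+ 2]mulr_natl.
Qed.

Lemma sqrt2pi_gt0 : 0 < Num.sqrt (2 * pi) :> R.
Proof. by rewrite sqrtr_gt0 mulr_gt0// pi_gt0. Qed.

Lemma gauss_pdf_gt0 x : 0 < gauss_pdf x.
Proof. by rewrite mulr_gt0 ?expR_gt0// invr_gt0 sqrt2pi_gt0. Qed.

Lemma gauss_pdf_le x : gauss_pdf x <= (Num.sqrt (2 * pi))^-1.
Proof.
rewrite /gauss_pdf ler_piMr ?invr_ge0 ?sqrtr_ge0// -expR0 ler_expR.
by rewrite oppr_le0 divr_ge0 ?sqr_ge0.
Qed.

Lemma gauss_pdfN x : gauss_pdf (- x) = gauss_pdf x.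
Proof. by rewrite /gauss_pdf sqrrN. Qed.

Lemma is_derive_gauss_pdf x : is_derive x 1 gauss_pdf (- x * gauss_pdf x).
Proof.
have h1 : is_derive x 1 (fun t : R => - (t ^+ 2 / 2)) (- x).
  rewrite (_ : (fun t => _) = (fun t : R => (- 2^-1) * (t * t))); last first.
    by apply/funext => t; rewrite expr2 mulNr mulrC.
  apply: is_derive_eq (is_deriveMl _ (is_deriveMf (is_derive_id _ _) (is_derive_id _ _))) _.
  by rewrite mulr1 mul1r; field.
apply: is_derive_eq (is_deriveMl _ (@is_derive1_comp _ expR _ _ _ _ (is_derive_expR _) h1)) _.
by rewrite /gauss_pdf; ring.
Qed.

Lemma integrable_gauss_pdf (A : set R) : measurable A ->
  lebesgue_measure.-integrable A (EFin \o gauss_pdf).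
Proof.
move=> mA; apply: (integrableS measurableT) => //.
by rewrite gauss_pdfE; exact: integrable_normal_pdf.
Qed.

Lemma gauss_cdf_expR x : gauss_cdf x = (Num.sqrt (2 * pi))^-1 *
  \int[lebesgue_measure]_(t in `]-oo, x]) expR (- (t ^+ 2 / 2)).
Proof.
have s0 := @sqrt2pi_gt0.
have E : (fun t : R => expR (- (t ^+ 2 / 2))) = fun t => Num.sqrt (2 * pi) * gauss_pdf t.
  by apply/funext => t; rewrite mulVKf// gt_eqF.
rewrite E RintegralZl//; first by rewrite mulKf// gt_eqF.
exact: integrable_gauss_pdf.
Qed.

Lemma is_derive_gauss_cdf x : is_derive x 1 gauss_cdf (gauss_pdf x).
Proof.
have [| | | |h1 h2] := @continuous_FTC1 R gauss_pdf -oo%O x (x + 1).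
- by rewrite ltrDl.
- by apply: integrable_gauss_pdf.
- by rewrite ltNyr.
- by rewrite gauss_pdfE; apply: continuous_normal_pdf; rewrite oner_neq0.
- exact: DeriveDef h1 (etrans (esym (derive1E _ _)) h2).
Qed.

Lemma gauss_cdfE x : gauss_cdf x = fine (normal_prob 0 1 `]-oo, x]).
Proof. by rewrite /gauss_cdf gauss_pdfE. Qed.

Lemma gauss_cdf_ge0 x : 0 <= gauss_cdf x.
Proof. by rewrite gauss_cdfE fine_ge0. Qed.

(** The identity is a random variable of law [normal_prob 0 1] whose [cdf] is [gauss_cdf]; the
    limits 0 and 1 at the two infinities are inherited from it. *)
Let idR : measurableTypeR R -> R := idfun.

#[local] HB.instance Definition _ :=
  @isMeasurableFun.Build _ _ _ _ idR (@measurable_id _ _ setT).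

Let normal_cdfE :
  gauss_cdf = fun r => fine (cdf (idR : {RV (normal_prob 0 1 : probability _ R) >-> R}) r).
Proof. by apply/funext => r; rewrite gauss_cdfE. Qed.

Lemma cvg_gauss_cdfNy : gauss_cdf x @[x --> -oo] --> (0 : R).
Proof. by rewrite normal_cdfE; exact/fine_cvg/cvg_cdfNy0. Qed.

Lemma cvg_gauss_cdfy : gauss_cdf x @[x --> +oo] --> (1 : R).
Proof. by rewrite normal_cdfE; exact/fine_cvg/cvg_cdfy1. Qed.

(** The density is even, so [gauss_cdf y + gauss_cdf (- y)] has derivative 0; letting [y] tend to
    +oo identifies the constant as 1. *)
Lemma gauss_cdfN x : gauss_cdf (- x) = 1 - gauss_cdf x.
Proof.
pose s (y : R) := gauss_cdf y + gauss_cdf (- y).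
have s0 (y : R) : is_derive y 1 s 0.
  apply: is_derive_eq (is_deriveDf (is_derive_gauss_cdf _)
    (is_derive_oppr (is_derive_gauss_cdf _))) _.
  by rewrite gauss_pdfN subrr.
have sE y : s y = s x by exact: is_derive_0_is_cst.
suff : s x = 1 by rewrite /s; lra.
have : s y @[y --> +oo] --> (1 + 0 : R).
  apply: cvgD; first exact: cvg_gauss_cdfy.
  by apply: cvg_comp cvg_gauss_cdfNy; rewrite ninfty; exact: cvg_id.
rewrite addr0 (_ : (fun y => s y) = cst (s x)); last exact/funext.
by move=> /cvg_lim <-//; rewrite lim_cst.
Qed.

Lemma gauss_cdf_nondecreasing x y : x <= y -> gauss_cdf x <= gauss_cdf y.
Proof.
move=> xy; apply: is_derive_nondecreasing xy _ _ => t _.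
- exact: is_derive_gauss_cdf.
- exact/ltW/gauss_pdf_gt0.
Qed.

Lemma gauss_cdf_le1 x : gauss_cdf x <= 1.
Proof. by have := gauss_cdf_ge0 (- x); rewrite gauss_cdfN; lra. Qed.

End gaussian.

(** * Taylor bounds, the Mills ratio and Gaussian tail estimates *)

Section mills.
Context {R : realType}.
Implicit Types x y w z : R.

(** A growth bound on [df] takes the place of a second derivative: the quadratic polynomial minus
    [f] has nonnegative derivative. *)
Lemma taylor1_le (f df : R -> R) (k x y : R) : x <= y ->
  (forall t, x <= t <= y -> is_derive t 1 f (df t)) ->
  (forall t, x <= t <= y -> df t <= df x + k * (t - x)) ->
  f y <= f x + (y - x) * df x + k / 2 * (y - x) ^+ 2.
Proof.
move=> xy fdf dfk.
pose g (t : R) := (f x + (t - x) * df x + k / 2 * ((t - x) * (t - x))) + - f t.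
suff : g x <= g y by rewrite /g !subrr !mul0r !mulr0 addr0 addr0 subrr; lra.
apply: (@is_derive_nondecreasing _ g (fun t => df x + k * (t - x) - df t) _ _ xy).
- move=> t txy; have d1 : is_derive t 1 (fun t : R => t - x) 1.
    by apply: is_derive_eq (is_deriveDf (is_derive_id _ _) (is_derive_cst _ _ _)) _; rewrite addr0.
  apply: is_derive_eq (is_deriveDf (is_deriveDf (is_deriveDf (is_derive_cst _ _ _)
     (is_deriveMf d1 (is_derive_cst _ _ _))) (is_deriveMl _ (is_deriveMf d1 d1)))
     (is_deriveNf (fdf _ txy))) _.
  by rewrite /cst/=; field.
- by move=> t /dfk; lra.
Qed.

Lemma taylor1 (f df : R -> R) (k x y : R) :
  (forall t, Num.min x y <= t <= Num.max x y -> is_derive t 1 f (df t)) ->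
  (forall t, Num.min x y <= t <= Num.max x y -> `|df t - df x| <= k * `|t - x|) ->
  `|f y - f x - (y - x) * df x| <= k / 2 * (y - x) ^+ 2.
Proof.
wlog xy : f df x y / x <= y.
  move=> H; have [xy|yx] := leP x y; first by have := H f df x y xy; rewrite min_l ?max_r.
  move=> fdf dfk.
  have yxN : - x <= - y by rewrite lerN2 ltW.
  have := H (fun t => f (- t)) (fun t => - df (- t)) (- x) (- y) yxN.
  rewrite min_l// max_r// !opprK.
  have -> : f y - f x - (- y + x) * - df x = f y - f x - (y - x) * df x by ring.
  have -> : (- y + x) ^+ 2 = (y - x) ^+ 2 by ring.
  apply=> t txy.
  - by apply/is_derive_oppr/fdf; lra.
  - have := dfk (- t); rewrite -[t + x]opprK normrN opprD => h.
    by rewrite -[X in `|X|]opprK normrN opprD opprK h//; lra.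
move=> fdf dfk; rewrite min_l// max_r// in fdf dfk.
have h1 := @taylor1_le f df k x y xy fdf.
have h2 := @taylor1_le (fun t => - f t) (fun t => - df t) k x y xy (fun t h => is_deriveNf (fdf t h)).
have xt t : x <= t <= y -> `|t - x| = t - x by move=> /andP[? _]; rewrite ger0_norm// subr_ge0.
rewrite ler_norml; apply/andP; split.
- suff : - f y <= - f x + (y - x) * - df x + k / 2 * (y - x) ^+ 2 by lra.
  by apply: h2 => t txy; have := dfk _ txy; rewrite (xt _ txy) ler_norml; lra.
- suff : f y <= f x + (y - x) * df x + k / 2 * (y - x) ^+ 2 by lra.
  by apply: h1 => t txy; have := dfk _ txy; rewrite (xt _ txy) ler_norml; lra.
Qed.

(* The expectation of max (z - Z, 0) for a standard normal Z. *)
Definition gauss_psi (z : R) : R := z * gauss_cdf z + gauss_pdf z.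
(* The Mills ratio of the left tail. *)
Definition mills (w : R) : R := gauss_cdf w / gauss_pdf w.

Lemma gauss_pdf_neq0 x : gauss_pdf x != 0.
Proof. by rewrite gt_eqF ?gauss_pdf_gt0. Qed.

Lemma mills_ge0 w : 0 <= mills w.
Proof. by rewrite divr_ge0 ?gauss_cdf_ge0// ltW ?gauss_pdf_gt0. Qed.

Lemma gauss_psiN z : gauss_psi (- z) = gauss_psi z - z.
Proof. by rewrite /gauss_psi gauss_cdfN gauss_pdfN; ring. Qed.

Lemma is_derive_gauss_psi z : is_derive z 1 gauss_psi (gauss_cdf z).
Proof.
apply: is_derive_eq (is_deriveDf (is_deriveMf (is_derive_id _ _)
  (is_derive_gauss_cdf _)) (is_derive_gauss_pdf _)) _.
by ring.
Qed.

Lemma is_derive_mills w : is_derive w 1 mills (1 + w * mills w).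
Proof.
apply: is_derive_eq (is_deriveMf (is_derive_gauss_cdf _)
  (is_deriveV (gauss_pdf_neq0 _) (is_derive_gauss_pdf _))) _.
rewrite /mills /GRing.scale/=; field; exact: gauss_pdf_neq0.
Qed.

Lemma mills_psi w : 1 + w * mills w = gauss_psi w / gauss_pdf w.
Proof. by rewrite /mills /gauss_psi; field; exact: gauss_pdf_neq0. Qed.

(** [1 + t * mills t] is the derivative of [mills], so the value here is its second derivative. *)
Lemma is_derive_mills_psi w :
  is_derive w 1 (fun t => 1 + t * mills t) (w + (1 + w ^+ 2) * mills w).
Proof.
apply: is_derive_eq (is_deriveDf (is_derive_cst _ _ _) (is_deriveMf (is_derive_id _ _)
  (is_derive_mills _))) _.
by ring.
Qed.

Lemma gauss_cdf_small (e z : R) : 0 < e -> exists2 y, y <= z & gauss_cdf y < e.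
Proof.
move=> e0; have /cvgrPdist_lt /(_ _ e0) [M [_ HM]] := @cvg_gauss_cdfNy R.
exists (Num.min z (M - 1)); first by rewrite ge_min lexx.
have := HM (Num.min z (M - 1)); rewrite sub0r normrN ger0_norm ?gauss_cdf_ge0//.
by apply; rewrite gt_min ltrBlDr ltrDl ltr01 orbT.
Qed.

Lemma gauss_psi_ge0 z : 0 <= gauss_psi z.
Proof.
have [z0|z0] := leP 0 z.
  by rewrite addr_ge0 ?mulr_ge0 ?gauss_cdf_ge0// ltW ?gauss_pdf_gt0.
(* For [z < 0] the claim is the tail bound [gauss_cdf z <= gauss_pdf z / (- z)]. Here [g] decreases
   on the negative axis from its limit 0 at -oo; instead of the limit, a point [y] with
   [gauss_cdf y < g z] gives the contradiction. *)
pose g (t : R) := gauss_pdf t * t^-1 + gauss_cdf t.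
suff : g z <= 0.
  have -> : gauss_psi z = z * g z by rewrite /g /gauss_psi; field; rewrite lt_eqF.
  by move=> gz; rewrite mulr_le0// ltW.
rewrite leNgt; apply/negP => /(gauss_cdf_small z)[y yz cy].
suff : g z <= g y.
  suff : gauss_pdf y * y^-1 <= 0 by rewrite /g in cy *; lra.
  by rewrite pmulr_rle0 ?gauss_pdf_gt0// invr_le0; lra.
rewrite -lerN2.
apply: (@is_derive_nondecreasing _ (fun t => - g t) (fun t => gauss_pdf t / t ^+ 2) y z yz).
- move=> t /andP[_ tz]; have t0 : t != 0 by rewrite lt_eqF// (le_lt_trans tz).
  apply: is_derive_eq (is_deriveNf (is_deriveDf (is_deriveMf (is_derive_gauss_pdf _)
    (is_deriveV t0 (is_derive_id _ _))) (is_derive_gauss_cdf _))) _.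
  by rewrite /GRing.scale/=; field.
- by move=> t _; rewrite divr_ge0 ?sqr_ge0// ltW ?gauss_pdf_gt0.
Qed.

(** Convexity of the Mills ratio. For [w < 0] it is the reverse tail bound [gauss_cdf w >= - w / (1
    + w ^+ 2) * gauss_pdf w]: the difference [g] of the two sides increases from its limit 0 at
    -oo. *)
Lemma mills_psi_deriv_ge0 w : 0 <= w + (1 + w ^+ 2) * mills w.
Proof.
have [w0|w0] := leP 0 w.
  by rewrite addr_ge0// mulr_ge0 ?mills_ge0// addr_ge0 ?sqr_ge0.
have D (t : R) : 1 + t * t != 0 by rewrite gt_eqF//; nra.
pose g (t : R) := gauss_pdf t * (t * (1 + t * t)^-1) + gauss_cdf t.
suff : 0 <= g w.
  have -> : w + (1 + w ^+ 2) * mills w = (1 + w * w) * (g w / gauss_pdf w).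
    by rewrite /mills /g; field; rewrite D gauss_pdf_neq0.
  move=> gw; rewrite mulr_ge0// ?divr_ge0// ?(ltW (gauss_pdf_gt0 _))//; nra.
have gle y : y <= w -> g y <= g w.
  move=> yw; apply: (@is_derive_nondecreasing _ g (fun t => 2 * gauss_pdf t / (1 + t * t) ^+ 2) y w yw).
  - move=> t _.
    have dD : is_derive t 1 (fun s : R => 1 + s * s) (2 * t).
      apply: is_derive_eq (is_deriveDf (is_derive_cst _ _ _)
        (is_deriveMf (is_derive_id _ _) (is_derive_id _ _))) _.
      by rewrite /=; ring.
    apply: is_derive_eq (is_deriveDf (is_deriveMf (is_derive_gauss_pdf _)
      (is_deriveMf (is_derive_id _ _) (@is_deriveV _ (fun s : R => 1 + s * s) _ _ _ (D t) dD)))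
      (is_derive_gauss_cdf _)) _.
    by rewrite /GRing.scale/=; field; exact: D.
  - by move=> t _; rewrite divr_ge0 ?sqr_ge0// mulr_ge0// ltW ?gauss_pdf_gt0.
rewrite leNgt; apply/negP => gw.
pose c : R := (Num.sqrt (2 * pi))^-1.
have c0 : 0 < c by rewrite invr_gt0 sqrt2pi_gt0.
(* [y] lies so far left that [c * y / (1 + y * y)], a lower bound of [g y], exceeds [g w]: from
   [y <= c / g w < 0] comes [y * y * g w <= c * y]. *)
pose y := Num.min w (c / g w).
have yw : y <= w by rewrite ge_min lexx.
have yc : y <= c / g w by rewrite ge_min lexx orbT.
have y0 : y < 0 by exact: le_lt_trans w0.
have := gle _ yw.
suff : g w < g y by move=> /lt_le_trans h /h; rewrite ltxx.
apply: (@lt_le_trans _ _ (c * (y * (1 + y * y)^-1))); last first.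
  rewrite /g -[leLHS]addr0 lerD ?gauss_cdf_ge0//.
  rewrite ler_wnM2r// ?gauss_pdf_le// pmulr_lle0 1?ltW// invr_gt0; nra.
have ygw : c <= y * g w by rewrite -ler_ndivlMr.
have D0 : 0 < 1 + y * y by nra.
rewrite mulrA ltr_pdivlMr//; nra.
Qed.

(** Up to the factor [gauss_pdf w], the left side is the Wronskian of the derivatives of [mills w]
    and [mills (- w)]. Both summands are nonnegative, so each is at most 1; this is the Lipschitz
    constant 1 of [stein_hinge_deriv]. *)
Lemma gauss_psi_mills_deriv w :
  gauss_psi w * (- w + (1 + w ^+ 2) * mills (- w)) +
  gauss_psi (- w) * (w + (1 + w ^+ 2) * mills w) = 1.
Proof.
rewrite gauss_psiN /gauss_psi /mills gauss_cdfN gauss_pdfN; field.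
exact: gauss_pdf_neq0.
Qed.

End mills.

(** * The Stein solution of a hinge: Lipschitz and Taylor bounds *)

Section hinge.
Context {R : realType}.
Implicit Types v w x y z : R.

(* The bounded solution of Stein's equation f' w - w f w = h w - E h(Z) for the
   hinge h w = max (z - w, 0), Z standard normal, and its derivative. *)
Definition stein_hinge z w : R :=
  if w <= z then 1 - mills w * gauss_psi (- z) else mills (- w) * gauss_psi z.

Definition stein_hinge_deriv z w : R :=
  if w <= z then - gauss_psi (- z) * (1 + w * mills w)
  else - gauss_psi z * (1 - w * mills (- w)).

Local Notation A := stein_hinge.
Local Notation B := stein_hinge_deriv.

(** Reflecting a hinge changes it by a linear function, whose Stein solution is a constant. The
    symmetry lets estimates be proved on one side of the knot [z]; at [w = z] it says that the two
    branches agree. *)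
Lemma stein_hingeN z w : A (- z) (- w) = 1 - A z w.
Proof.
rewrite /A lerN2; case: ltgtP => [zw|wz|->]; rewrite ?opprK; try ring.
rewrite gauss_psiN /mills gauss_cdfN gauss_pdfN /gauss_psi; field.
exact: gauss_pdf_neq0.
Qed.

Lemma stein_hinge_derivN z w : B (- z) (- w) = B z w.
Proof.
rewrite /B lerN2; case: ltgtP => [zw|wz|->]; rewrite ?opprK; try ring.
by rewrite !mills_psi gauss_pdfN; ring.
Qed.

Lemma stein_hinge_eq z w :
  B z w = w * A z w + Num.max (z - w) 0 - gauss_psi z.
Proof.
rewrite /A /B; case: leP => [wz|/ltW zw].
  by rewrite max_l ?subr_ge0// gauss_psiN; ring.
by rewrite max_r ?subr_le0//; ring.
Qed.

Let psi_mills_le1 w : 0 <= gauss_psi (- w) * (w + (1 + w ^+ 2) * mills w) <= 1.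
Proof.
have h1 := gauss_psi_mills_deriv w.
have h2 := mulr_ge0 (gauss_psi_ge0 w) (mills_psi_deriv_ge0 (- w)).
have h3 := mulr_ge0 (gauss_psi_ge0 (- w)) (mills_psi_deriv_ge0 w).
by rewrite sqrrN in h2; lra.
Qed.

(** Up to sign, this is the slope of [stein_hinge_deriv z] left of the knot; since [gauss_psi]
    increases, the worst knot is [z = w]. *)
Let slope_le1 z w : w <= z -> 0 <= gauss_psi (- z) * (w + (1 + w ^+ 2) * mills w) <= 1.
Proof.
move=> wz; rewrite mulr_ge0 ?gauss_psi_ge0 ?mills_psi_deriv_ge0//=.
apply: le_trans (_ : gauss_psi (- w) * (w + (1 + w ^+ 2) * mills w) <= 1); last first.
  by have /andP[] := psi_mills_le1 w.
rewrite ler_wpM2r ?mills_psi_deriv_ge0//.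
apply: (@is_derive_nondecreasing _ gauss_psi gauss_cdf); first by rewrite lerN2.
- by move=> t _; exact: is_derive_gauss_psi.
- by move=> t _; exact: gauss_cdf_ge0.
Qed.

Let lip_left z v w : v <= w -> w <= z -> `|B z w - B z v| <= w - v.
Proof.
move=> vw wz; rewrite /B wz (le_trans vw wz).
pose f t := gauss_psi (- z) * (1 + t * mills t).
have fd (t : R) : is_derive t 1 f (gauss_psi (- z) * (t + (1 + t ^+ 2) * mills t)).
  exact: is_deriveMl _ (is_derive_mills_psi _).
have : f v <= f w.
  apply: is_derive_nondecreasing vw (fun t _ => fd t) _ => t /andP[_ tw].
  by have /andP[] := slope_le1 (le_trans tw wz).
have : v - f v <= w - f w.
  apply: (is_derive_nondecreasing vw (fun t _ => is_deriveDf (is_derive_id _ _) (is_deriveNf (fd t)))) => t /andP[_ tw].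
  by have /andP[] := slope_le1 (le_trans tw wz); rewrite /=; lra.
rewrite /f => h1 h2; rewrite ler_norml; lra.
Qed.

Let lip_right z v w : z <= v -> v <= w -> `|B z w - B z v| <= w - v.
Proof.
move=> zv vw; rewrite -stein_hinge_derivN -[B z v]stein_hinge_derivN distrC.
have -> : w - v = - v - - w by ring.
by apply: lip_left; rewrite lerN2.
Qed.

Lemma stein_hinge_deriv_lip z v w : `|B z w - B z v| <= `|w - v|.
Proof.
wlog vw : v w / v <= w.
  by move=> H; have [|/ltW] := leP v w => /H//; rewrite distrC [X in _ <= X]distrC.
rewrite [leRHS]ger0_norm ?subr_ge0//.
have [wz|/ltW zw] := leP w z; first exact: lip_left.
have [zv|/ltW vz] := leP z v; first exact: lip_right.
have -> : B z w - B z v = (B z w - B z z) + (B z z - B z v) by ring.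
rewrite (le_trans (ler_normD _ _))//.
have := lip_left vz (lexx z); have := lip_right (lexx z) zw; lra.
Qed.

Let taylor_left z x y : x <= z -> y <= z ->
  `|A z y - A z x - (y - x) * B z x| <= 2^-1 * (y - x) ^+ 2.
Proof.
move=> xz yz; pose f t := 1 - mills t * gauss_psi (- z).
pose df t := - gauss_psi (- z) * (1 + t * mills t).
have -> : A z y = f y by rewrite /A yz.
have -> : A z x = f x by rewrite /A xz.
have -> : B z x = df x by rewrite /B xz.
rewrite -[2^-1]mul1r; apply: taylor1.
  move=> t _; apply: is_derive_eq (is_deriveDf (is_derive_cst _ _ _) (is_deriveNf
    (is_deriveMf (is_derive_mills _) (is_derive_cst (gauss_psi (- z)) _ _)))) _.
  by rewrite /df /cst/=; ring.
move=> t /andP[_]; rewrite le_max => txy.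
have tz : t <= z by move: txy => /orP[] /le_trans; apply.
have -> : df t = B z t by rewrite /B tz.
have -> : df x = B z x by rewrite /B xz.
by rewrite mul1r stein_hinge_deriv_lip.
Qed.

Let taylor_right z x y : z <= x -> z <= y ->
  `|A z y - A z x - (y - x) * B z x| <= 2^-1 * (y - x) ^+ 2.
Proof.
move=> zx zy; have := @taylor_left (- z) (- x) (- y).
rewrite !lerN2 !stein_hingeN stein_hinge_derivN => /(_ zx zy).
have -> : 1 - A z y - (1 - A z x) - (- y - - x) * B z x =
  - (A z y - A z x - (y - x) * B z x) by ring.
by rewrite normrN; have -> : (- y - - x) ^+ 2 = (y - x) ^+ 2 by ring.
Qed.

Lemma stein_hinge_taylor z x y :
  `|A z y - A z x - (y - x) * B z x| <= 2^-1 * (y - x) ^+ 2.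
Proof.
wlog xz : x y z / x <= z.
  move=> H; have [xz|zx] := leP x z; first exact: H.
  have := H (- x) (- y) (- z); rewrite !lerN2 !stein_hingeN stein_hinge_derivN.
  have -> : 1 - A z y - (1 - A z x) - (- y - - x) * B z x =
    - (A z y - A z x - (y - x) * B z x) by ring.
  rewrite normrN; have -> : (- y - - x) ^+ 2 = (y - x) ^+ 2 by ring.
  by apply; apply/ltW.
have [yz|/ltW zy] := leP y z; first exact: taylor_left.
(* For [x <= z <= y] the expansion passes through the knot in two stages; the two remainders and the
   change of derivative, at most [(y - z) * (z - x)], add up to exactly half of [(y - x) ^+ 2]. *)
have h1 := taylor_right (lexx z) zy; have h2 := taylor_left xz (lexx z).
have h3 := stein_hinge_deriv_lip z x z.
have -> : A z y - A z x - (y - x) * B z x =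
  (A z y - A z z - (y - z) * B z z) + (A z z - A z x - (z - x) * B z x) +
  (y - z) * (B z z - B z x) by ring.
have h4 : `|(y - z) * (B z z - B z x)| <= (y - z) * (z - x).
  rewrite normrM ger0_norm ?subr_ge0//.
  by move: h3; rewrite [ `|z - x| ]ger0_norm ?subr_ge0// => h3; rewrite ler_wpM2l ?subr_ge0.
rewrite (le_trans (ler_normD _ _))// (le_trans (lerD (ler_normD _ _) (lexx _)))//.
rewrite (le_trans (lerD (lerD h1 h2) h4))//.
by have -> : 2^-1 * (y - x) ^+ 2 = 2^-1 * (y - z) ^+ 2 + 2^-1 * (z - x) ^+ 2 +
   (y - z) * (z - x) by field.
Qed.

(** Nonnegativity of [gauss_psi (- w)] reads [w * gauss_cdf (- w) <= gauss_pdf w]; multiplied by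
    [gauss_cdf w], this gives the claim. It bounds the derivative of [stein_hinge_deriv] with
    respect to the knot. *)
Let cdf_psi_le1 w : gauss_cdf (- w) * (1 + w * mills w) <= 1.
Proof.
rewrite mills_psi mulrA ler_pdivrMr ?gauss_pdf_gt0// mul1r.
have := gauss_psi_ge0 (- w); rewrite gauss_psiN gauss_cdfN /gauss_psi.
have := gauss_cdf_ge0 w; have := gauss_cdf_le1 w; have := gauss_pdf_gt0 w.
move: (gauss_cdf w) (gauss_pdf w) => c p p0 c1 c0 h.
nra.
Qed.

Let lip_z_left w y z : w <= y -> y <= z -> `|B z w - B y w| <= z - y.
Proof.
move=> wy yz; rewrite /B wy (le_trans wy yz).
have d0 : 0 <= 1 + w * mills w.
  by rewrite mills_psi divr_ge0 ?gauss_psi_ge0// ltW ?gauss_pdf_gt0.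
pose f t := - gauss_psi (- t) * (1 + w * mills w).
have fd (t : R) : is_derive t 1 f (gauss_cdf (- t) * (1 + w * mills w)).
  apply: is_derive_eq (is_deriveMf (is_deriveNf (is_derive_oppr
    (is_derive_gauss_psi _))) (is_derive_cst (1 + w * mills w) _ _)) _.
  by rewrite /cst/=; ring.
have : f y <= f z.
  by apply: is_derive_nondecreasing yz (fun t _ => fd t) _ => t _; rewrite mulr_ge0// gauss_cdf_ge0.
have : y - f y <= z - f z.
  apply: (is_derive_nondecreasing yz (fun t _ => is_deriveDf (is_derive_id _ _) (is_deriveNf (fd t)))) => t /andP[yt _].
  rewrite /= subr_ge0 (le_trans _ (cdf_psi_le1 w))// ler_wpM2r// gauss_cdf_nondecreasing//.
  by rewrite lerN2 (le_trans wy).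
rewrite /f => h1 h2; rewrite ler_norml; lra.
Qed.

Let lip_z_right w y z : y <= z -> z <= w -> `|B z w - B y w| <= z - y.
Proof.
move=> yz zw; rewrite -stein_hinge_derivN -[B y w]stein_hinge_derivN distrC.
have -> : z - y = - y - - z by ring.
by apply: lip_z_left; rewrite lerN2.
Qed.

(** Divided by the width of a ramp, this difference becomes the derivative of the ramp's Stein
    solution, which is therefore bounded by 1. *)
Lemma stein_hinge_deriv_lip_knot w y z : y <= z -> `|B z w - B y w| <= z - y.
Proof.
move=> yz; have [wy|/ltW yw] := leP w y; first exact: lip_z_left.
have [zw|/ltW wz] := leP z w; first exact: lip_z_right.
have -> : B z w - B y w = (B z w - B w w) + (B w w - B y w) by ring.
rewrite (le_trans (ler_normD _ _))//.
have := lip_z_left (lexx w) wz; have := lip_z_right yw (lexx w); lra.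
Qed.

Lemma continuous_stein_hinge_deriv z : continuous (B z).
Proof.
move=> x; apply/cvgrPdist_le => e e0.
have /cvgrPdist_le/(_ _ e0) := @cvg_id _ (nbhs (x : R)); apply: filterS => y.
exact/le_trans/stein_hinge_deriv_lip.
Qed.

Lemma continuous_stein_hinge z : continuous (A z).
Proof.
move=> x; apply/cvgrPdist_le => e e0.
have b0 : 0 < `|B z x| + 1 by rewrite ltr_pwDr.
(* For [d = |x - y| <= 1] the Taylor bound gives [d ^+ 2 / 2 + d * |B z x| <= d * (|B z x| + 1) <=
   e]. *)
have e1 : 0 < Num.min 1 (e / (`|B z x| + 1)) by rewrite lt_min ltr01 divr_gt0.
have /cvgrPdist_le/(_ _ e1) := @cvg_id _ (nbhs (x : R)); apply: filterS => y.
rewrite le_min => /andP[d1 d2].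
have h := stein_hinge_taylor z x y; rewrite distrC.
have -> : A z y - A z x = (A z y - A z x - (y - x) * B z x) + (y - x) * B z x by ring.
rewrite (le_trans (ler_normD _ _))// (le_trans (lerD h (lexx _)))//.
rewrite -real_normK ?num_real// normrM distrC.
move: d2; rewrite ler_pdivlMr//.
have := normr_ge0 (x - y); have := normr_ge0 (B z x).
move: `|x - y| d1 `|B z x| => d d1 b b0' dp h'; nra.
Qed.

End hinge.

(** * Exchangeable pairs *)

Section bounded_measurable.
Context d (T : measurableType d) (R : realType).
Implicit Types f g : T -> R.

(** A class closed under the operations used below and integrable against every finite measure, so
    that [bmf_auto] settles the side conditions of linearity from the shape of the integrand. *)
Definition bmf f := measurable_fun setT f /\ exists M, forall x, `|f x| <= M.

Lemma bmf_cst c : bmf (fun=> c).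
Proof. by split; [exact: measurable_cst | exists `|c|]. Qed.

Lemma bmfD f g : bmf f -> bmf g -> bmf (fun x => f x + g x).
Proof.
move=> [mf [M fM]] [mg [N gN]]; split; first exact: measurable_funD.
by exists (M + N) => x; rewrite (le_trans (ler_normD _ _))// lerD.
Qed.

Lemma bmfM f g : bmf f -> bmf g -> bmf (fun x => f x * g x).
Proof.
move=> [mf [M fM]] [mg [N gN]]; split; first exact: measurable_funM.
by exists (M * N) => x; rewrite normrM ler_pM.
Qed.

Lemma bmfN f : bmf f -> bmf (fun x => - f x).
Proof.
move=> [mf [M fM]]; split; first exact: measurable_funN.
by exists M => x; rewrite normrN.
Qed.

Lemma bmfB f g : bmf f -> bmf g -> bmf (fun x => f x - g x).
Proof. by move=> bf bg; apply: bmfD => //; exact: bmfN. Qed.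

Lemma bmfX f n : bmf f -> bmf (fun x => f x ^+ n).
Proof.
move=> [mf [M fM]]; split; first exact: measurable_funX.
by exists (M ^+ n) => x; rewrite normrX lerXn2r ?nnegrE// (le_trans _ (fM x)).
Qed.

Lemma bmf_norm f : bmf f -> bmf (fun x => `|f x|).
Proof.
move=> [mf [M fM]]; split; first exact: measurableT_comp.
by exists M => x; rewrite normr_id.
Qed.

Lemma bmf_sum (I : Type) (s : seq I) (P : pred I) (F : I -> T -> R) :
  (forall i, P i -> bmf (F i)) -> bmf (fun x => \sum_(i <- s | P i) F i x).
Proof.
move=> bF; elim: s => [|i s IH].
  by under eq_fun do rewrite big_nil; exact: bmf_cst.
under eq_fun do rewrite big_cons; case: (boolP (P i)) => // Pi.
by apply: bmfD => //; exact: bF.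
Qed.

Lemma bmf_comp (h : R -> R) f : continuous h -> bmf f -> bmf (fun x => h (f x)).
Proof.
move=> ch [mf [M fM]]; split.
  by apply: measurableT_comp => //; exact: continuous_measurable_fun.
have ab : - `|M| <= `|M| by rewrite ge0_cp.
have cw : {within `[- `|M|, `|M|], continuous h} by exact: continuous_subspaceT.
have [c _ hc] := EVT_max ab cw.
have [c' _ hc'] := EVT_min ab cw.
exists (Num.max `|h c| `|h c'|) => x.
have fx : f x \in `[- `|M|, `|M|].
  by rewrite in_itv/= -ler_norml (le_trans (fM x))// ler_norm.
have := hc _ fx; have := hc' _ fx.
have := ler_norm (h c); have := ler_norm (- h c'); rewrite normrN.
by rewrite le_max ler_norml ler_norml => *; apply/orP; case: (lerP 0 (h (f x))) => ?; [left|right]; lra.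
Qed.

End bounded_measurable.

Ltac bmf_auto := repeat first
  [ assumption | apply: bmf_cst | (apply: bmf_comp; [assumption|]) | apply: bmfB | apply: bmfD | apply: bmfN
  | apply: bmfX | apply: bmfM | apply: bmf_norm | apply: bmf_sum => ? ?].

Lemma bmf_integrable d (T : measurableType d) (R : realType)
    (P : {finite_measure set T -> \bar R}) (f : T -> R) :
  bmf f -> P.-integrable setT (EFin \o f).
Proof.
move=> [mf [M fM]]; apply: (@le_integrable _ _ _ _ _ _ _ (EFin \o cst M)) => //.
- exact/measurable_EFinP.
- by move=> x _; rewrite /= lee_fin (le_trans (fM x))// ler_norm.
- exact: finite_measure_integrable_cst.
Qed.

Section expectation.
Context d (T : measurableType d) (R : realType) (P : probability T R).
Implicit Types f g : T -> R.

Lemma expD f g : bmf f -> bmf g ->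
  \int[P]_x (f x + g x) = \int[P]_x f x + \int[P]_x g x.
Proof. by move=> bf bg; rewrite RintegralD//; exact: bmf_integrable. Qed.

Lemma expB f g : bmf f -> bmf g ->
  \int[P]_x (f x - g x) = \int[P]_x f x - \int[P]_x g x.
Proof. by move=> bf bg; rewrite RintegralB//; exact: bmf_integrable. Qed.

Lemma expZ k f : bmf f -> \int[P]_x (k * f x) = k * \int[P]_x f x.
Proof. by move=> bf; rewrite RintegralZl//; exact: bmf_integrable. Qed.

Lemma expN f : bmf f -> \int[P]_x (- f x) = - \int[P]_x f x.
Proof.
by move=> bf; rewrite -mulN1r -expZ//; apply: eq_Rintegral => x _; rewrite mulN1r.
Qed.

Lemma exp_cst c : \int[P]_x c = c.
Proof.
have P1 : fine (P setT) = 1 by rewrite probability_setT.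
by rewrite Rintegral_cst// -[RHS]mulr1 -P1.
Qed.

Lemma exp_sum (I : Type) (s : seq I) (Q : pred I) (F : I -> T -> R) :
  (forall i, Q i -> bmf (F i)) ->
  \int[P]_x (\sum_(i <- s | Q i) F i x) = \sum_(i <- s | Q i) \int[P]_x F i x.
Proof.
move=> bF; elim: s => [|i s IH].
  by under eq_Rintegral do rewrite big_nil; rewrite exp_cst big_nil.
rewrite big_cons; under eq_Rintegral do rewrite big_cons.
case: (boolP (Q i)) => // Qi; rewrite expD ?IH//; [exact: bF|exact: bmf_sum].
Qed.

Lemma le_exp f g : bmf f -> bmf g -> (forall x, f x <= g x) ->
  \int[P]_x f x <= \int[P]_x g x.
Proof. by move=> bf bg fg; apply: le_Rintegral => //; exact: bmf_integrable. Qed.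

Lemma le_norm_exp f g : bmf f -> bmf g -> (forall x, `|f x| <= g x) ->
  `|\int[P]_x f x| <= \int[P]_x g x.
Proof.
move=> bf bg fg; rewrite (le_trans (le_normr_Rintegral _ _))//; first exact: bmf_integrable.
by apply: le_exp => //; exact: bmf_norm.
Qed.

Lemma exp_ge0 f : (forall x, 0 <= f x) -> 0 <= \int[P]_x f x.
Proof. by move=> f0; exact: Rintegral_ge0. Qed.

Lemma exp_cauchy_schwarz f g : bmf f -> bmf g ->
  (\int[P]_x (f x * g x)) ^+ 2 <= (\int[P]_x f x ^+ 2) * (\int[P]_x g x ^+ 2).
Proof.
move=> bf bg; set u := \int[P]_x (f x * g x); set v := \int[P]_x f x ^+ 2.
set w := \int[P]_x g x ^+ 2.
have H s t : 0 <= s ^+ 2 * v + t ^+ 2 * w + 2 * s * t * u.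
  rewrite /u /v /w -!expZ; try by bmf_auto.
  rewrite -!expD; try by bmf_auto.
  apply: exp_ge0 => x; have -> : s ^+ 2 * f x ^+ 2 + t ^+ 2 * g x ^+ 2 +
    2 * s * t * (f x * g x) = (s * f x + t * g x) ^+ 2 by ring.
  exact: sqr_ge0.
have v0 : 0 <= v by apply: exp_ge0 => x; exact: sqr_ge0.
have w0 : 0 <= w by apply: exp_ge0 => x; exact: sqr_ge0.
have [w00|wn0] := eqVneq w 0; last first.
  have wp : 0 < w by rewrite lt_neqAle eq_sym wn0.
  have := H w (- u).
  have -> : w ^+ 2 * v + (- u) ^+ 2 * w + 2 * w * - u * u = w * (v * w - u ^+ 2) by ring.
  by rewrite pmulr_rge0// subr_ge0.
rewrite w00 mulr0; have [->|u0] := eqVneq u 0; first by rewrite expr0n.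
(* With [w = 0] the form is affine in [t]; for a nonzero [u] this [t] gives it the value -1. *)
have := H 1 (- (v + 1) / (2 * u)); rewrite w00.
have -> : 1 ^+ 2 * v + (- (v + 1) / (2 * u)) ^+ 2 * 0 +
  2 * 1 * (- (v + 1) / (2 * u)) * u = - 1 by field.
by rewrite oppr_ge0 ler10.
Qed.

End expectation.

(** The best scale is [e = sqrt v / sqrt u]. If [u] or [v] vanishes, a large or a small [e] is used
    instead, chosen to contradict a strict excess of [p]. *)
Lemma le_optimize_scale (R : realType) (p t u v : R) : 0 <= u -> 0 <= v ->
  (forall e, 0 < e -> p <= t + u * e + v / e) -> p <= t + 2 * Num.sqrt (u * v).
Proof.
move=> u0 v0 H; rewrite leNgt; apply/negP => hp.
have [u00|un0] := eqVneq u 0.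
  rewrite u00 mul0r sqrtr0 mulr0 addr0 in hp.
  pose e := 2 * v / (p - t) + 1.
  have e0 : 0 < e by rewrite ltr_wpDl// divr_ge0 ?mulr_ge0// subr_ge0 ltW.
  have := H _ e0; rewrite u00 mul0r addr0 -lerBlDl ler_pdivlMr// /e.
  have -> : (p - t) * (2 * v / (p - t) + 1) = 2 * v + (p - t).
    by field; rewrite gt_eqF// subr_gt0.
  lra.
have up : 0 < u by rewrite lt_neqAle eq_sym un0.
have [v00|vn0] := eqVneq v 0.
  rewrite v00 mulr0 sqrtr0 mulr0 addr0 in hp.
  have e0 : 0 < (p - t) / (2 * u) by rewrite divr_gt0 ?subr_gt0// mulr_gt0.
  have := H _ e0; rewrite v00 mul0r addr0.
  have -> : u * ((p - t) / (2 * u)) = (p - t) / 2 by field.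
  lra.
have vp : 0 < v by rewrite lt_neqAle eq_sym vn0.
have su : 0 < Num.sqrt u by rewrite sqrtr_gt0.
have sv : 0 < Num.sqrt v by rewrite sqrtr_gt0.
have := H _ (divr_gt0 sv su); move: hp; rewrite sqrtrM//.
have -> : u * (Num.sqrt v / Num.sqrt u) = Num.sqrt u * Num.sqrt v.
  by rewrite -[X in X * _](sqr_sqrtr u0); field; rewrite gt_eqF.
have -> : v / (Num.sqrt v / Num.sqrt u) = Num.sqrt u * Num.sqrt v.
  by rewrite -[X in X / _](sqr_sqrtr v0); field; rewrite !gt_eqF.
lra.
Qed.

(** * Ramps and their Stein solutions *)

Section ramp.
Context {R : realType}.
Implicit Types z e w : R.

Definition ramp z e w : R := (Num.max (z + e - w) 0 - Num.max (z - w) 0) / e.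

Lemma continuous_max0B z : continuous (fun w : R => Num.max (z - w) 0).
Proof.
move=> w; apply: (@continuous_comp _ _ _ (fun w : R => z - w) (fun t => Num.max t 0)).
  by apply: cvgB; [exact: cvg_cst|exact: cvg_id].
by apply: continuous_max; [exact: cvg_id|exact: cvg_cst].
Qed.

Lemma continuous_ramp z e : continuous (ramp z e).
Proof.
move=> w; apply: cvgM; last exact: cvg_cst.
by apply: cvgB; exact: continuous_max0B.
Qed.

Lemma ramp_bounds z e w : 0 < e -> [/\ 0 <= ramp z e w <= 1,
  (w <= z -> ramp z e w = 1) & (z + e < w -> ramp z e w = 0)].
Proof.
move=> e0; rewrite /ramp; have en0 : e != 0 by rewrite gt_eqF.
case: (leP (z + e - w) 0) => h1; case: (leP (z - w) 0) => h2; split.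
all: try (by rewrite subrr mul0r ?lexx ?ler01).
all: try lra.
all: try (by rewrite subr0 divr_ge0 ?ler_pdivrMr//; lra).
all: try (by move=> ?; have -> : w = z by [lra]; field).
all: try (have -> : z + e - w - (z - w) = e by ring); rewrite ?divff// ?lexx ?ler01//.
all: lra.
Qed.

(** The solution is the difference quotient of hinge solutions between the knots [z] and [z + e].
    The Lipschitz bound in the knot gives [|f'| <= 1]; the two hinge remainders, each with constant
    1/2, add up to [(y - x) ^+ 2 / e]. *)
Lemma stein_ramp z e : 0 < e -> exists f f' : R -> R,
  [/\ continuous f, continuous f',
      forall w, f' w - w * f w = ramp z e w - (gauss_psi (z + e) - gauss_psi z) / e,
      forall w, `|f' w| <= 1
    & forall x y, `|f y - f x - (y - x) * f' x| <= (y - x) ^+ 2 / e].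
Proof.
move=> e0; have en0 : e != 0 by rewrite gt_eqF.
exists (fun w => (stein_hinge (z + e) w - stein_hinge z w) / e).
exists (fun w => (stein_hinge_deriv (z + e) w - stein_hinge_deriv z w) / e).
split=> [w|w|w|w|x y].
- apply: cvgM; last exact: cvg_cst.
  by apply: cvgB; exact: continuous_stein_hinge.
- apply: cvgM; last exact: cvg_cst.
  by apply: cvgB; exact: continuous_stein_hinge_deriv.
- by rewrite !stein_hinge_eq /ramp; field.
- rewrite normrM normfV (gtr0_norm e0) ler_pdivrMr// mul1r.
  have {2}-> : e = z + e - z by ring.
  by apply: stein_hinge_deriv_lip_knot; rewrite lerDl ltW.
- set l := (X in `|X|).
  have -> : l = ((stein_hinge (z + e) y - stein_hinge (z + e) x -
       (y - x) * stein_hinge_deriv (z + e) x) -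
     (stein_hinge z y - stein_hinge z x - (y - x) * stein_hinge_deriv z x)) / e.
    by rewrite /l; field.
  rewrite normrM normfV (gtr0_norm e0) ler_pM2r ?invr_gt0//.
  rewrite (le_trans (ler_normB _ _))//.
  have := stein_hinge_taylor (z + e) x y.
  have := stein_hinge_taylor z x y; lra.
Qed.

End ramp.

(** * Normal approximation for an exchangeable pair *)

Section exchangeable_pair.
Context d (T : measurableType d) (R : realType) (P : probability T R).
Variables (W W' S : T -> R) (a : R).
Hypotheses (bW : bmf W) (bW' : bmf W') (bS : bmf S) (a0 : 0 < a).

(** Weak forms of exchangeability and of two conditional expectations, each tested against
    continuous functions; [S] stands in for the conditional expectation of [(W' - W) ^+ 2]. *)
Hypothesis antisymmetry : forall f : R -> R, continuous f ->
  \int[P]_x ((W' x - W x) * (f (W' x) + f (W x))) = 0.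
Hypothesis regression : forall f : R -> R, continuous f ->
  \int[P]_x (W' x * f (W x)) = (1 - a) * \int[P]_x (W x * f (W x)).
Hypothesis conditional_square : forall f : R -> R, continuous f ->
  \int[P]_x ((W' x - W x) ^+ 2 * f (W x)) = \int[P]_x (S x * f (W x)).

Let V := Num.sqrt (\int[P]_x (1 - S x / (2 * a)) ^+ 2).
Let B3 := \int[P]_x `|W' x - W x| ^+ 3.

Lemma stein_ramp_bound (z e : R) : 0 < e ->
  `| \int[P]_x ramp z e (W x) - (gauss_psi (z + e) - gauss_psi z) / e |
  <= V + B3 / (2 * a * e).
Proof.
move=> e0; have en0 : e != 0 by rewrite gt_eqF.
have an0 : a != 0 by rewrite gt_eqF.
set N := (_ - gauss_psi z) / e.
have [f [f' [cf cf' stein f'1 taylor]]] := stein_ramp z e0.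
have cr := @continuous_ramp _ z e.
pose r x := f (W' x) - f (W x) - (W' x - W x) * f' (W x).
have rle x : `|r x| <= (W' x - W x) ^+ 2 / e by exact: taylor.
have br : bmf r by rewrite /r; bmf_auto.
(* Replacing [f (W' x)] in [antisymmetry] by its first-order expansion plus [r x], and applying
   [regression], isolates [2 * a] times the integral of [W * f (W)]. *)
have E1 : \int[P]_x (W x * f (W x)) =
   (2 * a)^-1 * (\int[P]_x ((W' x - W x) * r x) + \int[P]_x (S x * f' (W x))).
  rewrite -conditional_square// -expD; try by bmf_auto.
  have -> : \int[P]_x ((W' x - W x) * r x + (W' x - W x) ^+ 2 * f' (W x)) =
    \int[P]_x ((W' x - W x) * (f (W' x) + f (W x)) - (2 * (W' x * f (W x)) - 2 * (W x * f (W x)))).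
    by apply: eq_Rintegral => x _; rewrite /r; ring.
  rewrite expB; try by bmf_auto.
  rewrite expB; try by bmf_auto.
  rewrite !expZ; try by bmf_auto.
  by rewrite antisymmetry// regression//; field.
have -> : \int[P]_x ramp z e (W x) - N =
  \int[P]_x (f' (W x) * (1 - S x / (2 * a))) - (2 * a)^-1 * \int[P]_x ((W' x - W x) * r x).
  rewrite -[N in LHS](exp_cst P) -expB; try by bmf_auto.
  under eq_Rintegral do rewrite -stein.
  rewrite expB; try by bmf_auto.
  rewrite E1 mulrDr opprD addrA addrAC; congr (_ - _).
  rewrite -expZ; try by bmf_auto.
  rewrite -expB; try by bmf_auto.
  by apply: eq_Rintegral => x _; field.
(* The first term yields [V] by Cauchy-Schwarz and [|f'| <= 1]; the second yields the third moment,
   since [|r x|] is at most [(W' x - W x) ^+ 2 / e]. *)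
rewrite (le_trans (ler_normB _ _))// lerD//.
  rewrite /V -sqrtr_sqr ler_wsqrtr//.
  have bX : bmf (fun x => 1 - S x / (2 * a)) by bmf_auto.
  apply: le_trans (exp_cauchy_schwarz P (bmf_comp cf' bW) bX) _.
  rewrite ler_piMl ?exp_ge0//; first by move=> x; exact: sqr_ge0.
  rewrite -(exp_cst P 1); apply: le_exp; try by bmf_auto.
  by move=> x; rewrite -real_normK ?num_real// exprn_ile1.
have a2 : 0 < 2 * a by rewrite mulr_gt0.
rewrite normrM gtr0_norm ?invr_gt0//.
have -> : B3 / (2 * a * e) = (2 * a)^-1 * (e^-1 * B3) by field; rewrite en0.
rewrite ler_pM2l ?invr_gt0// /B3 -expZ; last by bmf_auto.
apply: le_norm_exp; try by bmf_auto.
move=> x; rewrite normrM exprS mulrCA ler_wpM2l//.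
by rewrite real_normK ?num_real// mulrC.
Qed.

(** The indicator of [W <= x0] lies between the ramps on [[x0 - e, x0]] and [[x0, x0 + e]]. The
    Gaussian mean of such a ramp is the average of [gauss_cdf] over its interval, off from
    [gauss_cdf x0] by at most [e / (2 * sqrt (2 * pi))]; [le_optimize_scale] then removes [e]. *)
Lemma stein_exchangeable_bound (x0 : R) :
  `| fine (P [set x | W x <= x0]) - gauss_cdf x0 |
  <= V + 2 * Num.sqrt ((2 * Num.sqrt (2 * pi))^-1 * (B3 / (2 * a))).
Proof.
have mW : measurable [set x | W x <= x0].
  rewrite [X in measurable X](_ : _ = W @^-1` `]-oo, x0]); last first.
    by apply/seteqP; split => x /=; rewrite in_itv.
  by rewrite -[X in measurable X]setTI; apply: bW.1.
have s0 := @sqrt2pi_gt0 R.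
apply: le_optimize_scale => [||e e0].
- by rewrite invr_ge0 mulr_ge0// ltW.
- apply: divr_ge0; last by rewrite mulr_ge0// ltW.
  by apply: exp_ge0 => x; exact: exprn_ge0.
set p := fine _; pose chi x : R := \1_[set x | W x <= x0] x.
have pE : p = \int[P]_x chi x by rewrite /chi /Rintegral integral_indic// setIT.
have bchi : bmf chi.
  split; first exact: measurable_indic.
  by exists 1 => x; rewrite /chi indicE; case: (_ \in _); rewrite ?normr1 ?normr0.
have psi_taylor (y h : R) : `|gauss_psi (y + h) - gauss_psi y - h * gauss_cdf y|
    <= (Num.sqrt (2 * pi))^-1 / 2 * h ^+ 2.
  have -> : h = y + h - y by ring.
  have -> : y + (y + h - y) = y + h by ring.
  apply: taylor1 => t _; first exact: is_derive_gauss_psi.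
  wlog ty : t y / y <= t.
    by move=> H; have [|/ltW] := leP y t => /H//; rewrite distrC [ `|y - t| ]distrC.
  have [c _ ->] := MVT_segment ty (fun s _ => is_derive_gauss_cdf s)
    (continuous_subspaceT (fun s => is_derive_cont (is_derive_gauss_cdf s))).
  by rewrite normrM ler_wpM2r// gtr0_norm ?gauss_pdf_gt0// gauss_pdf_le.
have vE : B3 / (2 * a) / e = B3 / (2 * a * e) by rewrite [in RHS]invfM mulrA.
have uE : (2 * Num.sqrt (2 * pi))^-1 * e = (Num.sqrt (2 * pi))^-1 / 2 * e.
  by rewrite invfM [_^-1 * _^-1]mulrC.
have bramp z : bmf (fun x => ramp z e (W x)).
  by apply: bmf_comp => //; exact: continuous_ramp.
rewrite ler_norml; apply/andP; split.
- have := stein_ramp_bound (x0 - e) e0; rewrite subrK.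
  have : \int[P]_x ramp (x0 - e) e (W x) <= p.
    rewrite pE; apply: le_exp => // x; rewrite /chi indicE.
    have [/andP[r0 r1] r2] := @ramp_bounds _ (x0 - e) e (W x) e0.
    rewrite subrK => r3; case: (boolP (x \in _)) => //.
    by rewrite notin_setE /= => /negP; rewrite -ltNge => /r3 ->.
  have := psi_taylor x0 (- e); rewrite sqrrN mulNr.
  rewrite vE uE !ler_norml => /andP[h1 h2] h3 /andP[h4 h5].
  have : gauss_cdf x0 - (Num.sqrt (2 * pi))^-1 / 2 * e <= (gauss_psi x0 - gauss_psi (x0 - e)) / e.
    rewrite ler_pdivlMr// mulrBl -mulrA; lra.
  lra.
- have := stein_ramp_bound x0 e0.
  have : p <= \int[P]_x ramp x0 e (W x).
    rewrite pE; apply: le_exp => // x; rewrite /chi indicE.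
    have [/andP[r0 r1] r2 r3] := @ramp_bounds _ x0 e (W x) e0.
    by case: (boolP (x \in _)) => // /set_mem /= /r2 ->.
  have := psi_taylor x0 e.
  rewrite vE uE !ler_norml => /andP[h1 h2] h3 /andP[h4 h5].
  have : (gauss_psi (x0 + e) - gauss_psi x0) / e <= gauss_cdf x0 + (Num.sqrt (2 * pi))^-1 / 2 * e.
    rewrite ler_pdivrMr// mulrDl -mulrA; lra.
  lra.
Qed.

End exchangeable_pair.

(** * Haar measure on compact groups *)

Section fubini_bmf.
Context d1 d2 (T1 : measurableType d1) (T2 : measurableType d2) (R : realType).
Variables (P : probability T1 R) (Q : probability T2 R) (F : T1 * T2 -> R).
Hypothesis bF : bmf F.

Let iF : (P \x Q)%E.-integrable setT (EFin \o F).
Proof. exact: (@bmf_integrable _ _ _ (product_subprobability (P : subprobability T1 R, Q : subprobability T2 R))). Qed.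

Lemma bmf_pair1 x : bmf (fun y => F (x, y)).
Proof.
have [mF [M FM]] := bF; split; last by exists M.
exact: measurable_fun_pair2.
Qed.

Lemma bmf_pair2 y : bmf (fun x => F (x, y)).
Proof.
have [mF [M FM]] := bF; split; last by exists M.
exact: measurable_fun_pair1.
Qed.

Lemma bmf_int1 : bmf (fun x => \int[Q]_y F (x, y)).
Proof.
have [mF [M FM]] := bF; split.
  exact/(measurableT_comp _ (measurable_fubini_F iF)).
exists M => x; rewrite -[leRHS](exp_cst Q); apply: le_norm_exp => //.
- exact: bmf_pair1.
- exact: bmf_cst.
Qed.

Lemma exp_exchange :
  \int[P]_x \int[Q]_y F (x, y) = \int[Q]_y \int[P]_x F (x, y).
Proof.
rewrite /Rintegral; congr fine.
have := Fubini iF; rewrite /= => H.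
transitivity (\int[P]_x \int[Q]_y (F (x, y))%:E)%E.
  apply: eq_integral => x _; rewrite fineK//.
  by apply: integrable_fin_num => //; apply: bmf_integrable; exact: bmf_pair1.
rewrite H; apply: eq_integral => y _; rewrite fineK//.
by apply: integrable_fin_num => //; apply: bmf_integrable; exact: bmf_pair2.
Qed.

End fubini_bmf.

Section continuous_group_ops.
Context (G : topologicalGroupType) (T : topologicalType).
Implicit Types u v : T -> G.

Lemma continuous_mulg u v : continuous u -> continuous v ->
  continuous (fun x => (u x * v x)%g).
Proof.
move=> cu cv x.
apply: (@continuous_comp _ _ _ (fun x => (u x, v x)) (fun z : G * G => (z.1 * z.2)%g)).
  by apply: cvg_pair; [exact: cu|exact: cv].
exact: mulg_continuous.
Qed.

Lemma continuous_invg u : continuous u -> continuous (fun x => (u x)^-1%g).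
Proof.
by move=> cu x; apply: (continuous_comp (cu x)); exact: invg_continuous.
Qed.

Lemma continuous_cstg (a : G) : continuous (fun _ : T => a).
Proof. by move=> x; exact: cvg_cst. Qed.

End continuous_group_ops.

Lemma continuous_idg (G : topologicalGroupType) : continuous (fun x : G => x).
Proof. by move=> x; exact: cvg_id. Qed.

Lemma continuous_fstg (G : topologicalGroupType) : continuous (fun x : G * G => x.1).
Proof. by move=> x; exact: cvg_fst. Qed.

Lemma continuous_sndg (G : topologicalGroupType) : continuous (fun x : G * G => x.2).
Proof. by move=> x; exact: cvg_snd. Qed.

Ltac group_continuous := repeat first
  [ assumption | exact: continuous_idg | exact: continuous_fstg | exact: continuous_sndg
  | exact: continuous_cstg | exact: invg_continuous
  | match goal with
    | |- continuous (fun x => (@?u x * @?v x)%g) => apply: (@continuous_mulg _ _ u v)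
    | |- continuous (fun x => (@?u x)^-1%g) => apply: (@continuous_invg _ _ u)
    | |- continuous (?h ?a) =>
        change (continuous (fun x => h a x)); apply: continuous_mulg
    end ].

Lemma continuous_compf (T U V : topologicalType) (f : U -> V) (g : T -> U) :
  continuous f -> continuous g -> continuous (fun x => f (g x)).
Proof. by move=> cf cg x; apply: continuous_comp; [exact: cg|exact: cf]. Qed.

(** * Invariance of Haar measure on a compact group *)

Section compact_group.
Context (R : realType) (G : topologicalGroupType).
Hypotheses (sc : @second_countable G) (cG : compact [set: G]).

Lemma bmf_continuous (f : G -> R) : continuous f -> bmf (f : borel G -> R).
Proof.
move=> cf; split.
  apply: (measurability _ (RGenOpens.measurableE R)) => _ [_ [x [y ->] <-]].
  rewrite setTI; apply: sub_sigma_algebra.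
  by move/continuousP : cf; apply; exact: interval_open.
have [c _ hc] := compact_EVT_max (ex_intro _ (1%g : G) I) cG (continuous_subspaceT cf).
have [c' _ hc'] := compact_EVT_min (ex_intro _ (1%g : G) I) cG (continuous_subspaceT cf).
exists (Num.max `|f c| `|f c'|) => x.
have := hc x (mem_set I); have := hc' x (mem_set I).
have := ler_norm (f c); have := ler_norm (- f c'); rewrite normrN.
by rewrite le_max ler_norml ler_norml => *; apply/orP; case: (lerP 0 (f x)) => ?; [left|right]; lra.
Qed.

(** The product sigma-algebra is generated by rectangles; second countability writes an open set as
    a countable union of open rectangles. Hence continuous functions on [G * G] are admissible in
    Fubini's theorem. *)
Lemma open_measurable_prod (A : set (G * G)) : open A ->
  measurable (A : set (borel G * borel G)).
Proof.
move=> oA; have [B cB [Bo Bn]] := sc.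
pose D := [set p : set G * set G | [/\ B p.1, B p.2 & p.1 `*` p.2 `<=` A]].
have cD : countable D.
  apply: (@sub_countable _ _ _ (B `*` B)); last exact: countableX.
  by apply: subset_card_le => -[U V] [].
have -> : A = \bigcup_(p in D) (p.1 `*` p.2).
  apply/seteqP; split => [[x y] Axy|[x y] [p [_ _]]]; last by apply.
  have [[U V] [/= nU nV] UVA] := (open_nbhs_nbhs (conj oA Axy) : nbhs (x, y) A).
  have [U' [BU' U'x] U'U] := Bn x _ nU.
  have [V' [BV' V'y] V'V] := Bn y _ nV.
  exists (U', V') => //; split => //= -[u v] [/= U'u V'v].
  by apply: UVA; split => /=; [exact: U'U|exact: V'V].
rewrite bigcup_set_type; apply: countable_bigcupT_measurable.
  by rewrite (eq_countable (card_setT _)).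
move=> [[U V] /= /set_mem[/= BU BV _]].
by apply: measurableX; apply: sub_sigma_algebra; exact: Bo.
Qed.

Lemma bmf_continuous2 (F : G * G -> R) : continuous F ->
  bmf (F : borel G * borel G -> R).
Proof.
move=> cf; split.
  apply: (measurability _ (RGenOpens.measurableE R)) => _ [_ [x [y ->] <-]].
  rewrite setTI; apply: open_measurable_prod.
  by move/continuousP : cf; apply; exact: interval_open.
have cGG : compact [set: G * G] by rewrite -setXTT; exact: compact_setX.
have ne : [set: G * G] !=set0 by exists (1%g, 1%g).
have [c _ hc] := compact_EVT_max ne cGG (continuous_subspaceT cf).
have [c' _ hc'] := compact_EVT_min ne cGG (continuous_subspaceT cf).
exists (Num.max `|F c| `|F c'|) => x.
have := hc x (mem_set I); have := hc' x (mem_set I).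
have := ler_norm (F c); have := ler_norm (- F c'); rewrite normrN.
by rewrite le_max ler_norml ler_norml => *; apply/orP; case: (lerP 0 (F x)) => ?; [left|right]; lra.
Qed.

Section haar.
Variables (H : set G) (m : probability (borel G) R).
Hypotheses (sH : subgroup H) (mH : measurable (H : set (borel G))) (hH : haar_on H m).

Lemma subgroupV x : H x -> H (x^-1)%g.
Proof. by move=> Hx; rewrite -[(x^-1)%g]mul1g; apply: sH.2 => //; exact: sH.1. Qed.

Lemma eq_exp_carrier (f g : borel G -> R) : bmf f -> bmf g ->
  (forall x, H x -> f x = g x) -> \int[m]_x f x = \int[m]_x g x.
Proof.
move=> bf bg fg; congr fine; apply: ae_eq_integral => //.
- by apply/measurable_EFinP; case: bf.
- by apply/measurable_EFinP; case: bg.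
- exists (~` H); split; first exact: measurableC.
    by have := probability_setC m mH; rewrite (hH.1 : m H = 1%E) subee.
  by move=> x /= /not_implyP[_ fgx] Hx; apply: fgx; rewrite fg.
Qed.

Lemma haar_left (f : G -> R) a : continuous f -> H a ->
  \int[m]_x f (a * x)%g = \int[m]_x f x.
Proof.
move=> cf Ha; pose l (x : G) : G := (a * x)%g.
have cl : continuous l by rewrite /l; group_continuous.
have ml : measurable_fun setT (l : borel G -> borel G).
  apply: (@measurability _ _ (borel G) (borel G) setT l (@open G) erefl) => // _ [U oU <-]; rewrite setTI.
  by apply: sub_sigma_algebra; move/continuousP : cl; apply.
congr fine; transitivity (\int[pushforward m (l : borel G -> borel G)]_x ((f : borel G -> R) x)%:E)%E.
  rewrite integral_pushforward//=.
  - by apply/measurable_EFinP; case: (bmf_continuous cf).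
  - apply: bmf_integrable; apply: bmf_continuous => x.
    by apply: continuous_comp; [exact: cl|exact: cf].
apply: eq_measure_integral => A mA _; exact: hH.2.
Qed.

(** If integrating out [y] leaves a constant on [H], averaging over [H] and exchanging the integrals
    keeps it. This brings an average over [K] under an integral over [G]. *)
Lemma exp_average (mu : probability (borel G) R) (F : G * G -> R) c : continuous F ->
  (forall x, H x -> \int[mu]_y F (x, y) = c) -> \int[mu]_y \int[m]_x F (x, y) = c.
Proof.
move=> cF Hc; have bF := bmf_continuous2 cF.
rewrite -(@exp_exchange _ _ (borel G) (borel G) R m mu F bF) -[RHS](exp_cst m).
apply: eq_exp_carrier => //; last exact: bmf_cst.
exact: (@bmf_int1 _ _ (borel G) (borel G) R m mu F bF).
Qed.

(* The double integral of f (x^-1 y) is the integral of f by invariance in y, and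
   that of [fun x => f x^-1] by invariance in x. *)
Lemma haar_inv (f : G -> R) : continuous f ->
  \int[m]_x f (x^-1)%g = \int[m]_x f x.
Proof.
move=> cf; pose F (z : G * G) : R := f (z.1^-1 * z.2)%g.
pose F' (z : G * G) : R := f ((z.1^-1 * z.2)^-1)%g.
have cF : continuous F by apply: continuous_compf => //; group_continuous.
have cF' : continuous F' by apply: continuous_compf => //; group_continuous.
have cfV : continuous (fun x => f (x^-1)%g).
  by apply: continuous_compf => //; group_continuous.
have <- : \int[m]_y \int[m]_x F (x, y) = \int[m]_x f x.
  by apply: exp_average => // x Hx; exact: (haar_left cf (subgroupV Hx)).
have <- : \int[m]_y \int[m]_x F' (x, y) = \int[m]_x f (x^-1)%g.
  apply: exp_average => // x Hx.
  exact: (@haar_left (fun x => f (x^-1)%g) (x^-1)%g cfV (subgroupV Hx)).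
rewrite -(@exp_exchange _ _ (borel G) (borel G) R m m F (bmf_continuous2 cF)).
apply: eq_Rintegral => y _; apply: eq_Rintegral => x _.
by rewrite /F /F' /= invgM invgK.
Qed.

(** Inversion exchanges right and left translations, so [haar_inv] reduces this to left
    invariance. *)
Lemma haar_right (f : G -> R) a : continuous f -> H a ->
  \int[m]_x f (x * a)%g = \int[m]_x f x.
Proof.
move=> cf Ha; have cfV : continuous (fun x => f (x^-1)%g).
  by apply: continuous_compf => //; group_continuous.
rewrite -haar_inv; last by apply: continuous_compf => //; group_continuous.
rewrite -[RHS]haar_inv// -(haar_left (a := a^-1%g) cfV); last exact: subgroupV.
by apply: eq_Rintegral => x _; rewrite invgM invgK.
Qed.

End haar.

Lemma haar_eq0 (m : probability (borel G) R) (f : G -> R) :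
  haar_on [set: G] m -> continuous f -> (forall x, 0 <= f x) ->
  \int[m]_x f x = 0 -> forall x, f x = 0.
Proof.
move=> hm cf f0 If x0; apply/eqP; rewrite eq_le f0 andbT leNgt; apply/negP => fx0.
(* Finitely many translates of an open set where f is large cover G. *)
pose U g := [set x : G | f x0 / 2 < f (g * x)%g].
have Uo g : open (U g).
  have : continuous (fun x : G => f (g * x)%g).
    by apply: continuous_compf => //; group_continuous.
  by move/continuousP => /(_ _ (@open_gt R (f x0 / 2))).
have [|D _ DU] := (eq_ind _ (fun P => P [set: G]) cG _ (@compact_cover G)) G setT U (fun g _ => Uo g).
  move=> x _; exists (x0 * x^-1)%g => //.
  rewrite /U /= mulgVK.
  lra.
have cD g : bmf (fun x : borel G => f (g * x)%g).
  by apply: bmf_continuous; apply: continuous_compf => //; group_continuous.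
have : \int[m]_x (f x0 / 2) <= \int[m]_x (\sum_(g <- enum_fset D) f (g * x)%g).
  apply: le_exp; [exact: bmf_cst|by apply: bmf_sum|move=> x].
  have [g gD] := DU x I; rewrite /U /= => fg.
  by rewrite (big_rem g)//= ler_wpDr ?(ltW fg)// sumr_ge0.
rewrite exp_cst exp_sum// big1 => [|g _]; first by lra.
by rewrite (haar_left hm cf I).
Qed.

End compact_group.

(** * Complex-valued functions and their integrals *)

Section complex_coordinates.
Context {R : realType}.
Implicit Types z w : R[i].

Lemma complexP z w : complex.Re z = complex.Re w -> complex.Im z = complex.Im w -> z = w.
Proof. by case: z w => [a b] [c e] /= -> ->. Qed.

Lemma cReD z w : complex.Re (z + w) = complex.Re z + complex.Re w.
Proof. by case: z w => [a b] [c e]. Qed.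
Lemma cImD z w : complex.Im (z + w) = complex.Im z + complex.Im w.
Proof. by case: z w => [a b] [c e]. Qed.
Lemma cReN z : complex.Re (- z) = - complex.Re z.
Proof. by case: z. Qed.
Lemma cImN z : complex.Im (- z) = - complex.Im z.
Proof. by case: z. Qed.
Lemma cReM z w : complex.Re (z * w) =
  complex.Re z * complex.Re w - complex.Im z * complex.Im w.
Proof. by case: z w => [a b] [c e]. Qed.
Lemma cImM z w : complex.Im (z * w) =
  complex.Re z * complex.Im w + complex.Im z * complex.Re w.
Proof. by case: z w => [a b] [c e]. Qed.
Lemma cReJ z : complex.Re (z^*) = complex.Re z.
Proof. by case: z. Qed.
Lemma cImJ z : complex.Im (z^*) = - complex.Im z.
Proof. by case: z. Qed.
Lemma cJD z w : (z + w)^* = z^* + w^*.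
Proof. by apply: complexP; rewrite !(cReD, cImD, cReJ, cImJ) ?opprD. Qed.
Lemma cJN z : (- z)^* = - z^*.
Proof. by apply: complexP; rewrite !(cReN, cImN, cReJ, cImJ). Qed.
Lemma cJM z w : (z * w)^* = z^* * w^*.
Proof. by apply: complexP; rewrite !(cReM, cImM, cReJ, cImJ); ring. Qed.
Lemma cJK z : (z^*)^* = z.
Proof. by apply: complexP; rewrite !(cReJ, cImJ) ?opprK. Qed.
Lemma cJ_real (x : R) : (x%:C)^* = x%:C.
Proof. by apply: complexP; rewrite ?cReJ ?cImJ//= oppr0. Qed.
Lemma cRe_nat n : complex.Re (n%:R : R[i]) = n%:R.
Proof. by elim: n => // n IH; rewrite -!natr1 cReD IH. Qed.
Lemma cRe_sum (I : Type) (s : seq I) (P : pred I) (F : I -> R[i]) :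
  complex.Re (\sum_(i <- s | P i) F i) = \sum_(i <- s | P i) complex.Re (F i).
Proof. exact: (big_morph (@complex.Re R) cReD). Qed.
Lemma cJ_sum (I : Type) (s : seq I) (P : pred I) (F : I -> R[i]) :
  (\sum_(i <- s | P i) F i)^* = \sum_(i <- s | P i) (F i)^*.
Proof. exact: (big_morph (@conjc R) cJD (conjc0 R)). Qed.

Lemma sqr_normc_Re_Im z : Normc.normc z ^+ 2 = complex.Re z ^+ 2 + complex.Im z ^+ 2.
Proof. by case: z => a b /=; rewrite sqr_sqrtr// addr_ge0 ?sqr_ge0. Qed.

Lemma mulcJ z : z * z^* = (Normc.normc z ^+ 2)%:C.
Proof.
apply: complexP; rewrite ?cReM ?cImM cReJ cImJ /= ?sqr_normc_Re_Im; ring.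
Qed.

End complex_coordinates.

Definition ccont (R : realType) (T : topologicalType) (f : T -> R[i]) :=
  continuous (fun x => complex.Re (f x)) /\ continuous (fun x => complex.Im (f x)).

Section ccont_theory.
Context {R : realType} {T : topologicalType}.
Implicit Types f g : T -> R[i].

Lemma ccont_cst (c : R[i]) : ccont (fun _ : T => c).
Proof. by split=> x; exact: cvg_cst. Qed.

Lemma ccontD f g : ccont f -> ccont g -> ccont (fun x => f x + g x).
Proof.
move=> [f1 f2] [g1 g2]; split.
  by under eq_fun do rewrite cReD; move=> x; apply: cvgD; [exact: f1|exact: g1].
by under eq_fun do rewrite cImD; move=> x; apply: cvgD; [exact: f2|exact: g2].
Qed.

Lemma ccontN f : ccont f -> ccont (fun x => - f x).
Proof.
move=> [f1 f2]; split.
  by under eq_fun do rewrite cReN; move=> x; apply: cvgN; exact: f1.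
by under eq_fun do rewrite cImN; move=> x; apply: cvgN; exact: f2.
Qed.

Lemma ccontB f g : ccont f -> ccont g -> ccont (fun x => f x - g x).
Proof. by move=> cf cg; apply: ccontD => //; exact: ccontN. Qed.

Lemma ccontM f g : ccont f -> ccont g -> ccont (fun x => f x * g x).
Proof.
move=> [f1 f2] [g1 g2]; split.
  under eq_fun do rewrite cReM; move=> x; apply: cvgB; apply: cvgM;
    by [exact: f1|exact: g1|exact: f2|exact: g2].
under eq_fun do rewrite cImM; move=> x; apply: cvgD; apply: cvgM;
  by [exact: f1|exact: g1|exact: f2|exact: g2].
Qed.

Lemma ccontJ f : ccont f -> ccont (fun x => (f x)^*).
Proof.
move=> [f1 f2]; split; first by under eq_fun do rewrite cReJ.
by under eq_fun do rewrite cImJ; move=> x; apply: cvgN; exact: f2.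
Qed.

Lemma ccont_sum (I : Type) (s : seq I) (P : pred I) (F : I -> T -> R[i]) :
  (forall i, P i -> ccont (F i)) -> ccont (fun x => \sum_(i <- s | P i) F i x).
Proof.
move=> cF; elim: s => [|i s IH].
  by under eq_fun do rewrite big_nil; exact: ccont_cst.
under eq_fun do rewrite big_cons; case: (boolP (P i)) => // Pi.
by apply: ccontD => //; exact: cF.
Qed.

Lemma ccontX f n : ccont f -> ccont (fun x => f x ^+ n).
Proof.
move=> cf; elim: n => [|n IH]; first by under eq_fun do rewrite expr0; exact: ccont_cst.
by under eq_fun do rewrite exprS; exact: ccontM.
Qed.

Lemma ccont_real (u : T -> R) : continuous u -> ccont (fun x => (u x)%:C).
Proof. by move=> cu; split=> //= x; exact: cvg_cst. Qed.

End ccont_theory.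

Lemma ccont_comp (R : realType) (T U : topologicalType) (f : U -> R[i]) (g : T -> U) :
  ccont f -> continuous g -> ccont (fun x => f (g x)).
Proof. by move=> [f1 f2] cg; split; [exact: (continuous_compf f1 cg)|exact: (continuous_compf f2 cg)]. Qed.

Ltac ccont_auto := repeat first
  [ match goal with
    | |- ccont (fun x => @?f x + @?g x) => apply: (@ccontD _ _ f g)
    | |- ccont (fun x => - @?f x) => apply: (@ccontN _ _ f)
    | |- ccont (fun x => @?f x * @?g x) => apply: (@ccontM _ _ f g)
    | |- ccont (fun x => (@?f x)^*) => apply: (@ccontJ _ _ f)
    | |- ccont (fun x => @?f x ^+ ?n) => apply: (@ccontX _ _ f n)
    | |- ccont (fun x => \sum_(i <- ?s | @?P i) @?f i x) =>
        apply: (@ccont_sum _ _ _ s P (fun i x => f i x)) => ? ?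
    | |- ccont (fun x => ?f (@?u x)) =>
        apply: (@ccont_comp _ _ _ f u); [assumption | solve [group_continuous]]
    end
  | exact: ccont_cst | assumption ].

Section complex_integral.
Context (R : realType) (G : topologicalGroupType).
Hypotheses (sc : @second_countable G) (cG : compact [set: G]).
Variable m : probability (borel G) R.
Implicit Types f g : G -> R[i].

Local Notation I f := (Cintegral m setT f).

Let bRe f : ccont f -> bmf (fun x : borel G => complex.Re (f x)).
Proof. by move=> [c _]; exact: bmf_continuous. Qed.
Let bIm f : ccont f -> bmf (fun x : borel G => complex.Im (f x)).
Proof. by move=> [_ c]; exact: bmf_continuous. Qed.

Let IRe f : complex.Re (I f) = \int[m]_x complex.Re (f x). Proof. by []. Qed.
Let IIm f : complex.Im (I f) = \int[m]_x complex.Im (f x). Proof. by []. Qed.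

Lemma eq_Cintegral f g : f =1 g -> I f = I g.
Proof. by move=> fg; congr Cintegral; exact/funext. Qed.

Lemma Cintegral_cst c : I (fun=> c) = c.
Proof. by apply: complexP; rewrite ?IRe ?IIm exp_cst. Qed.

Lemma CintegralD f g : ccont f -> ccont g -> I (fun x => f x + g x) = I f + I g.
Proof.
move=> cf cg; have [? ? ? ?] := And4 (bRe cf) (bIm cf) (bRe cg) (bIm cg).
apply: complexP; rewrite ?cReD ?cImD ?IRe ?IIm -expD//; apply: eq_Rintegral => x _.
  exact: cReD.
exact: cImD.
Qed.

Lemma CintegralN f : ccont f -> I (fun x => - f x) = - I f.
Proof.
move=> cf; have [? ?] := conj (bRe cf) (bIm cf).
apply: complexP; rewrite ?cReN ?cImN ?IRe ?IIm -expN//; apply: eq_Rintegral => x _.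
  exact: cReN.
exact: cImN.
Qed.

Lemma CintegralB f g : ccont f -> ccont g -> I (fun x => f x - g x) = I f - I g.
Proof. by move=> cf cg; rewrite CintegralD ?CintegralN//; exact: ccontN. Qed.

Lemma CintegralZ c f : ccont f -> I (fun x => c * f x) = c * I f.
Proof.
move=> cf; have ? := bRe cf; have ? := bIm cf.
apply: complexP; rewrite ?cReM ?cImM ?IRe ?IIm -!expZ//.
  rewrite -expB; try by bmf_auto.
  by apply: eq_Rintegral => x _; rewrite cReM.
rewrite -expD; try by bmf_auto.
by apply: eq_Rintegral => x _; rewrite cImM.
Qed.

Lemma CintegralZr c f : ccont f -> I (fun x => f x * c) = I f * c.
Proof.
by move=> cf; rewrite mulrC -CintegralZ//; apply: eq_Cintegral => x; rewrite mulrC.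
Qed.

Lemma CintegralJ f : ccont f -> I (fun x => (f x)^*) = (I f)^*.
Proof.
move=> cf; have ? := bIm cf; apply: complexP; rewrite ?cReJ ?cImJ ?IRe ?IIm.
  by apply: eq_Rintegral => x _; rewrite cReJ.
by rewrite -expN//; apply: eq_Rintegral => x _; rewrite cImJ.
Qed.

Lemma Cintegral_sum (J : Type) (s : seq J) (P : pred J) (F : J -> G -> R[i]) :
  (forall i, P i -> ccont (F i)) ->
  I (fun x => \sum_(i <- s | P i) F i x) = \sum_(i <- s | P i) I (F i).
Proof.
move=> cF; elim: s => [|i s IH].
  by rewrite big_nil -[RHS](Cintegral_cst 0); apply: eq_Cintegral => x; rewrite big_nil.
rewrite big_cons.
have -> : I (fun x => \sum_(j <- i :: s | P j) F j x) =
   I (fun x => if P i then F i x + \sum_(j <- s | P j) F j x else \sum_(j <- s | P j) F j x).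
  by apply: eq_Cintegral => x; rewrite big_cons.
by case: (boolP (P i)) => // Pi; rewrite CintegralD ?IH//; [exact: cF|exact: ccont_sum].
Qed.

Lemma Cintegral_normc f :
  I (fun x => f x * (f x)^*) = (\int[m]_x (Normc.normc (f x) ^+ 2))%:C.
Proof.
apply: complexP; rewrite ?IRe ?IIm; first by apply: eq_Rintegral => x _; rewrite mulcJ.
by rewrite -[RHS](exp_cst m); apply: eq_Rintegral => x _; rewrite mulcJ.
Qed.

Lemma ccont_normc f : ccont f -> continuous (fun x => Normc.normc (f x) ^+ 2).
Proof.
move=> cf; have [+ _] := ccontM cf (ccontJ cf).
by under eq_fun do rewrite mulcJ /=.
Qed.

Lemma Cintegral_norm_eq0 f : haar_on [set: G] m -> ccont f ->
  I (fun x => f x * (f x)^*) = 0 -> forall x, f x = 0.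
Proof.
move=> hm cf; rewrite Cintegral_normc => -[If] x.
have := haar_eq0 cG hm (ccont_normc cf) (fun x => sqr_ge0 _) If x.
by move=> /eqP; rewrite sqrf_eq0 => /eqP; exact: Normc.eq0_normc.
Qed.

Section haar.
Variables (H : set G).
Hypotheses (sH : subgroup H) (mH : measurable (H : set (borel G))) (hH : haar_on H m).

(** The measure is carried by [H], so the integral over [K] in the definition of [spherical] may be
    taken over all of [G], where the linearity rules are stated. *)
Lemma Cintegral_carrier f : ccont f -> Cintegral m H f = I f.
Proof.
move=> cf; have m0 : m (~` H) = 0%E.
  by have := probability_setC m mH; rewrite (hH.1 : m H = 1%E) subee.
have E (h : borel G -> R) : bmf h -> \int[m]_(x in H) h x = \int[m]_x h x.
  move=> bh; congr fine; rewrite (negligible_integral (measurableC mH) measurableT _ m0) ?setTD ?setCK//.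
  exact: bmf_integrable.
by apply: complexP; rewrite ?IRe ?IIm -E//; [exact: bRe|exact: bIm].
Qed.

Lemma Cintegral_left f a : ccont f -> H a -> I (fun x => f (a * x)%g) = I f.
Proof. by move=> [f1 f2] Ha; apply: complexP; rewrite ?IRe ?IIm; exact: (haar_left cG hH _ Ha). Qed.

Lemma Cintegral_right f a : ccont f -> H a -> I (fun x => f (x * a)%g) = I f.
Proof.
by move=> [f1 f2] Ha; apply: complexP; rewrite ?IRe ?IIm; exact: (haar_right sc cG sH mH hH _ Ha).
Qed.

Lemma Cintegral_inv f : ccont f -> I (fun x => f (x^-1)%g) = I f.
Proof. by move=> [f1 f2]; apply: complexP; rewrite ?IRe ?IIm; exact: (haar_inv sc cG sH mH hH). Qed.

Lemma Cintegral_average (mu : probability (borel G) R) (F : G * G -> R[i]) c : ccont F ->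
  (forall x, H x -> Cintegral mu setT (fun y => F (x, y)) = c) ->
  Cintegral mu setT (fun y => I (fun x => F (x, y))) = c.
Proof.
move=> [F1 F2] Hc; apply: complexP.
  have := exp_average sc cG mH hH (c := complex.Re c) F1.
  by apply=> x /Hc <-.
have := exp_average sc cG mH hH (c := complex.Im c) F2.
by apply=> x /Hc <-.
Qed.

End haar.

End complex_integral.

Section finite_rank.
Context (R : realType) (G : topologicalGroupType).
Implicit Types f g : G -> R[i].

(** All left translates of [f] lie in the span of the finitely many [v i]. In this form the property
    passes to sums, products and conjugates without any notion of dimension. *)
Definition finite_rank f := exists (J : finType) (c v : J -> G -> R[i]),
  (forall i, ccont (v i)) /\ forall z y, f (z * y)%g = \sum_i c i z * v i y.

Lemma finite_rankD f g : finite_rank f -> finite_rank g ->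
  finite_rank (fun x => f x + g x).
Proof.
move=> [J [c [v [cv fE]]]] [J' [c' [v' [cv' gE]]]].
exists (J + J')%type, (fun i => match i with inl j => c j | inr j => c' j end),
  (fun i => match i with inl j => v j | inr j => v' j end); split=> [[]//|z y].
by rewrite fE gE big_sumType.
Qed.

Lemma finite_rankM f g : finite_rank f -> finite_rank g ->
  finite_rank (fun x => f x * g x).
Proof.
move=> [J [c [v [cv fE]]]] [J' [c' [v' [cv' gE]]]].
exists (J * J')%type, (fun i z => c i.1 z * c' i.2 z), (fun i y => v i.1 y * v' i.2 y).
split=> [i|z y]; first exact: ccontM.
rewrite fE gE big_distrlr pair_big /=; apply: eq_bigr => i _; ring.
Qed.

Lemma finite_rankJ f : finite_rank f -> finite_rank (fun x => (f x)^*).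
Proof.
move=> [J [c [v [cv fE]]]].
exists J, (fun i z => (c i z)^*), (fun i y => (v i y)^*).
split=> [i|z y]; first exact: ccontJ.
by rewrite fE cJ_sum; apply: eq_bigr => i _; rewrite cJM.
Qed.

End finite_rank.

Lemma ler_powR4 (R : realType) (x y : R) : 0 <= x -> 0 <= y -> x ^+ 4 <= y -> x <= y `^ 4^-1.
Proof.
move=> x0 y0 xy.
have -> : x = (x ^+ 4) `^ 4^-1.
  by rewrite -powR_mulrn// -powRrM mulfV ?powRr1.
by apply: ge0_ler_powR; rewrite ?nnegrE ?exprn_ge0.
Qed.

Lemma cReZ (R : realType) (x : R) (z : R[i]) : complex.Re (x%:C * z) = x * complex.Re z.
Proof. by case: z => u v /=; rewrite mul0r subr0. Qed.

(** * Spherical functions *)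

Section spherical_functions.
Context (R : realType) (G : topologicalGroupType).
Hypotheses (sc : @second_countable G) (cG : compact [set: G]).
Variables (K : set G) (mu nu : probability (borel G) R).
Hypotheses (sK : subgroup K) (mK : measurable (K : set (borel G))).
Hypotheses (hG : haar_on [set: G] mu) (hK : haar_on K nu).
Implicit Types f phi psi : G -> R[i].

Local Notation I f := (Cintegral mu setT f).
Local Notation sph := (spherical mu nu K).

Let sG : subgroup [set: G]. Proof. by []. Qed.
Let mG : measurable ([set: G] : set (borel G)). Proof. exact: measurableT. Qed.

Lemma haarG_left f a : ccont f -> I (fun x => f (a * x)%g) = I f.
Proof. by move=> cf; exact: (Cintegral_left cG hG cf). Qed.

Lemma haarG_right f a : ccont f -> I (fun x => f (x * a)%g) = I f.
Proof. by move=> cf; exact: (Cintegral_right sc cG sG mG hG cf). Qed.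

Lemma haarG_inv f : ccont f -> I (fun x => f (x^-1)%g) = I f.
Proof. by move=> cf; exact: (Cintegral_inv sc cG sG mG hG cf). Qed.

Lemma spherical_ccont phi : sph phi -> ccont phi.
Proof. by case=> _ []. Qed.

Lemma spherical_right phi x k : sph phi -> K k -> phi (x * k)%g = phi x.
Proof. by case=> -[_ _ + _] _ _ _; exact. Qed.

Lemma spherical1 phi : sph phi -> phi 1%g = 1.
Proof. by case. Qed.

Lemma spherical_eq phi x y : sph phi ->
  Cintegral nu setT (fun k => phi (x * k * y)%g) = phi x * phi y.
Proof.
move=> sphi; have c := spherical_ccont sphi.
case: sphi => _ _ _ <-; rewrite (Cintegral_carrier cG mK hK)//; ccont_auto.
Qed.

(** With 1 as left argument the functional equation makes [phi] its own average over left translates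
    by [K]; right invariance of [nu] absorbs [k]. *)
Lemma spherical_left phi x k : sph phi -> K k -> phi (k * x)%g = phi x.
Proof.
move=> sphi Kk; have c := spherical_ccont sphi.
have E y : Cintegral nu setT (fun l => phi (l * y)%g) = phi y.
  rewrite -[RHS]mul1r -(spherical1 sphi) -(spherical_eq _ _ sphi).
  by apply: eq_Cintegral => l; rewrite mul1g.
rewrite -E -[RHS]E; under eq_Cintegral do rewrite mulgA.
have cx : ccont (fun l => phi (l * x)%g) by ccont_auto.
exact: (Cintegral_right sc cG sK mK hK cx Kk).
Qed.

(* Averaging over K the translation invariance [y |-> k * y] of the integral
   turns [phi (z * k * y)] into [phi z * phi y]. *)
Lemma Cintegral_spherical_left phi psi z : sph phi -> ccont psi ->
  (forall k x, K k -> psi (k * x)%g = psi x) ->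
  I (fun y => phi (z * y)%g * psi y) = phi z * I (fun y => phi y * psi y).
Proof.
move=> sphi cpsi psiK; have c := spherical_ccont sphi.
rewrite -(CintegralZ cG); last by ccont_auto.
pose F (p : G * G) := phi (z * p.1 * p.2)%g * psi p.2.
have cF : ccont F.
  apply: ccontM; first by apply: (@ccont_comp _ _ _ phi) => //; group_continuous.
  by apply: (@ccont_comp _ _ _ psi) => //; group_continuous.
have FE k : K k -> I (fun y => F (k, y)) = I (fun y => phi (z * y)%g * psi y).
  move=> Kk; have cz : ccont (fun y => phi (z * y)%g * psi y) by ccont_auto.
  rewrite -(haarG_left k cz); apply: eq_Cintegral => y.
  by rewrite /F /= psiK// mulgA.
rewrite -(Cintegral_average sc cG mK hK cF FE); apply: eq_Cintegral => y.
rewrite /F /= (CintegralZr cG) ?spherical_eq ?mulrA//; ccont_auto.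
Qed.

(** The same averaging, by [y |-> y * k] on the right. With [z = alpha] it is the regression
    property of the step from [g] to [g * alpha]. *)
Lemma Cintegral_spherical_right phi psi z : sph phi -> ccont psi ->
  (forall k x, K k -> psi (x * k)%g = psi x) ->
  I (fun y => phi (y * z)%g * psi y) = phi z * I (fun y => phi y * psi y).
Proof.
move=> sphi cpsi psiK; have c := spherical_ccont sphi.
rewrite -(CintegralZ cG); last by ccont_auto.
pose F (p : G * G) := phi (p.2 * p.1 * z)%g * psi p.2.
have cF : ccont F.
  apply: ccontM; first by apply: (@ccont_comp _ _ _ phi) => //; group_continuous.
  by apply: (@ccont_comp _ _ _ psi) => //; group_continuous.
have FE k : K k -> I (fun y => F (k, y)) = I (fun y => phi (y * z)%g * psi y).
  move=> Kk; have cz : ccont (fun y => phi (y * z)%g * psi y) by ccont_auto.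
  rewrite -(haarG_right k cz); apply: eq_Cintegral => y.
  by rewrite /F /= psiK.
rewrite -(Cintegral_average sc cG mK hK cF FE); apply: eq_Cintegral => y.
rewrite /F /= (CintegralZr cG) ?spherical_eq //; last by ccont_auto.
by rewrite mulrA [phi y * _]mulrC.
Qed.

(** * The inner product and orthogonality of spherical functions *)

Definition inner f g : R[i] := I (fun x => f x * (g x)^*).
Definition sqnorm f : R := \int[mu]_x (Normc.normc (f x) ^+ 2).

Lemma inner_sqnorm f : inner f f = (sqnorm f)%:C.
Proof. exact: Cintegral_normc. Qed.

Lemma inner_conj f g : ccont f -> ccont g -> inner g f = (inner f g)^*.
Proof.
move=> cf cg; rewrite /inner -(CintegralJ cG); last by ccont_auto.
apply: eq_Cintegral => x; rewrite cJM cJK. by rewrite mulrC.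
Qed.

Lemma sqnorm_ge0 f : 0 <= sqnorm f.
Proof. by apply: exp_ge0 => x; exact: sqr_ge0. Qed.

Lemma sqnorm_eq0 f : ccont f -> sqnorm f = 0 -> forall x, f x = 0.
Proof.
by move=> cf f0; apply: (Cintegral_norm_eq0 cG hG cf); rewrite -/(inner f f) inner_sqnorm f0.
Qed.

Lemma sqnorm_gt0 phi : sph phi -> 0 < sqnorm phi.
Proof.
move=> sphi; rewrite lt_neqAle sqnorm_ge0 andbT eq_sym; apply/eqP => p0.
have := sqnorm_eq0 (spherical_ccont sphi) p0 1%g.
by rewrite spherical1// => /eqP; rewrite oner_eq0.
Qed.

Lemma inner_spherical_left phi psi z : sph phi -> ccont psi ->
  (forall k x, K k -> psi (k * x)%g = psi x) ->
  inner (fun y => phi (z * y)%g) psi = phi z * inner phi psi.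
Proof.
move=> sphi cpsi psiK; rewrite /inner.
apply: (@Cintegral_spherical_left phi (fun y => (psi y)^*)) => //; first by ccont_auto.
by move=> k x Kk; rewrite psiK.
Qed.

(** Left translation is unitary: the inner product of [phi (x^-1 * _)] with [phi] equals that of
    [phi] with [phi (x * _)]. The two are [phi x^-1] and the conjugate of [phi x], both times
    [sqnorm phi]. *)
Lemma spherical_inv phi x : sph phi -> phi (x^-1)%g = (phi x)^*.
Proof.
move=> sphi; have c := spherical_ccont sphi; have n0 := sqnorm_gt0 sphi.
have n1 : inner phi phi != 0 by rewrite inner_sqnorm eq_complex /= gt_eqF.
apply: (mulIf n1); rewrite -inner_spherical_left//; last first.
  by move=> k y Kk; exact: spherical_left.
have -> : (phi x)^* * inner phi phi = (phi x * inner phi phi)^*.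
  by rewrite cJM -inner_conj.
rewrite -inner_spherical_left//; last first.
  by move=> k y Kk; exact: spherical_left.
rewrite -inner_conj//; last by ccont_auto.
have cx : ccont (fun y => phi (x^-1 * y)%g * (phi y)^*) by ccont_auto.
rewrite /inner -(haarG_left x cx).
by apply: eq_Cintegral => y; rewrite mulKg.
Qed.

Lemma spherical_conj phi : sph phi -> sph (fun x => (phi x)^*).
Proof.
move=> sphi; have c := spherical_ccont sphi; case: (sphi) => -[m1 m2 r i] _ p1 e.
split=> [|||x y].
- split.
  + by under eq_fun do rewrite cReJ.
  + by under eq_fun do rewrite cImJ; exact: measurable_funN.
  + by move=> x k Kk; rewrite r.
  + under eq_integral => x _.
      have -> : Normc.normc (phi x)^* = Normc.normc (phi x).
        by case: (phi x) => u v /=; rewrite sqrrN.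
      over.
    by [].
- exact: ccontJ.
- by rewrite p1 rmorph1.
- rewrite -cJM -e (Cintegral_carrier cG mK hK); last by ccont_auto.
  rewrite (Cintegral_carrier cG mK hK); last by ccont_auto.
  by rewrite (CintegralJ cG)//; ccont_auto.
Qed.

Lemma spherical_cst1 : sph (cst 1).
Proof.
split=> [|||x y] //.
- split=> //.
  rewrite (eq_integral (cst 1%E)) => [|x _]; last by rewrite sqr_normc_Re_Im /= expr1n expr0n addr0.
  by have mu1 := hG.1; rewrite integral_cst// mul1e [X in (X < _)%E]mu1 ltry.
- by split=> x; exact: cvg_cst.
- rewrite (Cintegral_carrier cG mK hK); last exact: ccont_cst.
  by rewrite Cintegral_cst mulr1.
Qed.

(** The squared norm of [phi (x * _) - phi] is [2 * (1 - Re (phi x)) * sqnorm phi]. *)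
Lemma spherical_le1 phi x : sph phi -> complex.Re (phi x) <= 1.
Proof.
move=> sphi; have c := spherical_ccont sphi; have n0 := sqnorm_gt0 sphi.
have cx : ccont (fun y => phi (x * y)%g) by ccont_auto.
pose D y := phi (x * y)%g - phi y.
have : complex.Re (inner D D) = 2 * sqnorm phi - 2 * (complex.Re (phi x) * sqnorm phi).
  have -> : inner D D = inner (fun y => phi (x * y)%g) (fun y => phi (x * y)%g)
      - inner (fun y => phi (x * y)%g) phi
      - ((inner (fun y => phi (x * y)%g) phi)^* - inner phi phi).
    rewrite -inner_conj// /inner -!(CintegralB cG); try by ccont_auto.
    by apply: eq_Cintegral => y; rewrite /D cJD cJN; ring.
  have -> : inner (fun y => phi (x * y)%g) (fun y => phi (x * y)%g) = inner phi phi.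
    have cc : ccont (fun y => phi y * (phi y)^*) by ccont_auto.
    by rewrite /inner -(haarG_left x cc).
  rewrite inner_spherical_left//; last by move=> k y Kk; exact: spherical_left.
  rewrite inner_sqnorm !(cReD, cReN, cReM, cReJ) /=; ring.
rewrite inner_sqnorm /= => H; have := sqnorm_ge0 D; rewrite H.
by rewrite -mulrBr pmulr_rge0// -[X in X - _]mul1r -mulrBl pmulr_lge0// subr_ge0.
Qed.

(** Both [phi z * inner phi psi] and [psi z * inner phi psi] equal the inner product of
    [phi (z * _)] with [psi], so a nonzero [inner phi psi] would make the two functions equal. *)
Lemma spherical_orthogonal phi psi : sph phi -> sph psi -> phi <> psi ->
  inner phi psi = 0.
Proof.
move=> sphi spsi npp; have cp := spherical_ccont sphi; have cs := spherical_ccont spsi.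
apply/eqP/negP => /negP n0; apply: npp; apply/funext => z.
apply: (mulIf n0); rewrite -inner_spherical_left//; last first.
  by move=> k y Kk; exact: spherical_left.
have -> : psi z * inner phi psi = (psi z^-1%g * inner psi phi)^*.
  by rewrite cJM -inner_conj// spherical_inv// cJK.
rewrite -inner_spherical_left//; last by move=> k y Kk; exact: spherical_left.
rewrite -inner_conj//; last by ccont_auto.
have cx : ccont (fun y => phi (z * y)%g * (psi y)^*) by ccont_auto.
rewrite /inner -(haarG_left z^-1%g cx).
by apply: eq_Cintegral => y; rewrite mulVKg.
Qed.

Lemma innerBl f g h : ccont f -> ccont g -> ccont h ->
  inner (fun x => f x - g x) h = inner f h - inner g h.
Proof.
move=> cf cg ch; rewrite /inner -(CintegralB cG); try by ccont_auto.
by apply: eq_Cintegral => x; rewrite mulrBl.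
Qed.

Lemma innerBr f g h : ccont f -> ccont g -> ccont h ->
  inner h (fun x => f x - g x) = inner h f - inner h g.
Proof.
move=> cf cg ch; rewrite /inner -(CintegralB cG); try by ccont_auto.
by apply: eq_Cintegral => x; rewrite cJD cJN mulrBr.
Qed.

Lemma inner_suml (J : Type) (s : seq J) (P : pred J) (c : J -> R[i]) (b : J -> G -> R[i]) g :
  (forall i, P i -> ccont (b i)) -> ccont g ->
  inner (fun x => \sum_(i <- s | P i) c i * b i x) g =
  \sum_(i <- s | P i) c i * inner (b i) g.
Proof.
move=> cb cg; under eq_bigr => i Pi.
  rewrite /inner -(CintegralZ cG); last by ccont_auto; exact: cb.
  over.
rewrite -(Cintegral_sum cG); last by move=> i Pi; ccont_auto; exact: cb.
by apply: eq_Cintegral => x; rewrite mulr_suml; apply: eq_bigr => i _; rewrite mulrA.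
Qed.

Lemma inner_sumr (J : Type) (s : seq J) (P : pred J) (c : J -> R[i]) (b : J -> G -> R[i]) g :
  (forall i, P i -> ccont (b i)) -> ccont g ->
  inner g (fun x => \sum_(i <- s | P i) c i * b i x) =
  \sum_(i <- s | P i) (c i)^* * inner g (b i).
Proof.
move=> cb cg; rewrite (inner_conj) //; last first.
  by apply: ccont_sum => i Pi; apply: ccontM; [exact: ccont_cst|exact: cb].
rewrite inner_suml// cJ_sum; apply: eq_bigr => i Pi.
by rewrite cJM -(inner_conj)//; exact: cb.
Qed.

Lemma Hspace_ccont phi f : sph phi -> Hspace phi f -> ccont f.
Proof.
move=> sphi [n [c [h ->]]]; have cp := spherical_ccont sphi.
by apply: ccont_sum => i _; ccont_auto.
Qed.

Lemma Hspace_translate phi h : Hspace phi (fun x => phi (h^-1 * x)%g).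
Proof.
exists 1%N, (fun=> 1), (fun=> h); apply/funext => x.
by rewrite big_ord1 mul1r.
Qed.

(** By linearity only a translate [phi (h^-1 * _)] matters; shifting by [x] leaves the inner product
    of [phi (h^-1 * x * _)] with [phi]. *)
Lemma Hspace_reproducing phi f x : sph phi -> Hspace phi f ->
  inner f (fun y => phi (x^-1 * y)%g) = f x * (sqnorm phi)%:C.
Proof.
move=> sphi [n [c [h ->]]]; have cp := spherical_ccont sphi.
rewrite inner_suml => [|j _|]; [|by ccont_auto|by ccont_auto].
rewrite mulr_suml; apply: eq_bigr => i _; rewrite -mulrA; congr (_ * _).
have cx : ccont (fun y => phi ((h i)^-1 * y)%g * (phi (x^-1 * y)%g)^*) by ccont_auto.
rewrite /inner -(haarG_left x cx) -inner_sqnorm.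
rewrite -(inner_spherical_left (phi := phi) (psi := phi))//; last first.
  by move=> k y Kk; exact: (spherical_left _ sphi Kk).
by apply: eq_Cintegral => y; rewrite mulKg mulgA.
Qed.

(** * The dimension of [Hspace phi] through Gram matrices *)

Definition independent n (b : 'I_n -> G -> R[i]) := forall c : 'I_n -> R[i],
  (forall x, \sum_(i < n) c i * b i x = 0) -> forall i, c i = 0.

Section gram.
Variables (n : nat) (b : 'I_n -> G -> R[i]).
Hypotheses (cb : forall i, ccont (b i)) (ib : independent b).

Let gram : 'M[R[i]]_n := \matrix_(i, j) inner (b i) (b j).

Lemma gram_unit : gram \in unitmx.
Proof.
rewrite -row_free_unit; apply: inj_row_free => v vG.
pose f x := \sum_(i < n) v 0 i * b i x.
have cf : ccont f by apply: ccont_sum => i _; apply: ccontM; [exact: ccont_cst|exact: cb].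
have : inner f f = 0.
  rewrite {2}/f inner_sumr// big1// => j _; rewrite inner_suml//.
  suff -> : \sum_i v 0 i * inner (b i) (b j) = 0 by rewrite mulr0.
  have /matrixP/(_ 0 j) := vG; rewrite !mxE => h; rewrite -[RHS]h.
  by apply: eq_bigr => i _; rewrite mxE.
move=> /(Cintegral_norm_eq0 cG hG cf) f0.
by apply/rowP => i; rewrite mxE; exact: (ib f0).
Qed.

Variable phi : G -> R[i].
Hypotheses (sphi : sph phi) (bH : forall i, Hspace phi (b i)).
Let N : R[i] := (sqnorm phi)%:C.
Let cp := spherical_ccont sphi.

(* Coordinates of the orthogonal projection of [phi (x^-1 * _)] on the span of b. *)
Let c x i := N * \sum_j (b j x)^* * invmx gram j i.
Let s x := \sum_i c x i * b i x.

Let cE x j : \sum_i c x i * gram i j = N * (b j x)^*.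
Proof.
transitivity (N * ((\row_k (b k x)^*) *m invmx gram *m gram) 0 j).
  rewrite mxE mulr_sumr; apply: eq_bigr => i _; rewrite mulrA; congr (_ * _ * _).
  by rewrite mxE; apply: eq_bigr => k _; rewrite mxE.
by rewrite mulmxKV ?gram_unit// mxE.
Qed.

(** Up to the factor [N], [s] is the diagonal of the kernel of the orthogonal projection onto the
    span of [b]; its integral is a trace, that of [invmx gram *m gram]. *)
Let int_s : I s = N * n%:R.
Proof.
rewrite /s (Cintegral_sum cG) => [|i _]; last first.
  apply: ccontM => //; apply: ccontM; first exact: ccont_cst.
  by apply: ccont_sum => j _; apply: ccontM; [exact: ccontJ|exact: ccont_cst].
transitivity (N * \tr (invmx gram *m gram)); last by rewrite mulVmx ?gram_unit// mxtrace1.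
rewrite mulr_sumr.
transitivity (\sum_i \sum_j N * (invmx gram j i * gram i j)); last first.
  by rewrite exchange_big; apply: eq_bigr => j _; rewrite mxE mulr_sumr.
apply: eq_bigr => i _.
transitivity (I (fun x => \sum_j (N * invmx gram j i) * (b i x * (b j x)^*))).
  apply: eq_Cintegral => x; rewrite /c mulr_sumr mulr_suml; apply: eq_bigr => j _; ring.
rewrite (Cintegral_sum cG) => [|j _]; last first.
  by apply: ccontM; [exact: ccont_cst|apply: ccontM => //; exact: ccontJ].
apply: eq_bigr => j _; rewrite (CintegralZ cG); last by apply: ccontM => //; exact: ccontJ.
by rewrite -mulrA [in RHS]mxE.
Qed.

(** Pythagoras: the squared distance from [phi (x^-1 * _)] to its projection [q] is
    [N * (1 - s x)]. *)
Let re_s_le1 x : complex.Re (s x) <= 1.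
Proof.
pose px y := phi (x^-1 * y)%g; pose q y := \sum_i c x i * b i y.
have cpx : ccont px by rewrite /px; ccont_auto.
have cq : ccont q by apply: ccont_sum => i _; apply: ccontM; [exact: ccont_cst|exact: cb].
have Npx : inner px px = N.
  have cx : ccont (fun y => phi y * (phi y)^*) by ccont_auto.
  by rewrite /N -inner_sqnorm /inner -(haarG_left x^-1%g cx).
have qpx : inner q px = N * s x.
  rewrite /q inner_suml// /s mulr_sumr; apply: eq_bigr => i _.
  by rewrite Hspace_reproducing// mulrA mulrC.
have qq : inner q q = N * (s x)^*.
  rewrite {2}/q inner_sumr// /s cJ_sum mulr_sumr; apply: eq_bigr => j _.
  rewrite /q inner_suml// cJM [in RHS]mulrCA; congr (_ * _).
  by rewrite -cE; apply: eq_bigr => i _; rewrite mxE.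
pose D y := px y - q y.
have : inner D D = N * (1 - s x).
  rewrite /D innerBl// ?innerBr//; try exact: ccontB.
  rewrite Npx qpx qq (inner_conj cq cpx) qpx cJM /N cJ_real.
  by ring.
rewrite inner_sqnorm => H.
have := sqnorm_ge0 D; have := congr1 (@complex.Re R) H.
rewrite /N cReM cReD cReN /= mul0r subr0 => ->.
by rewrite pmulr_rge0 ?subr_ge0// (sqnorm_gt0 sphi).
Qed.

Lemma gram_dim_le1 : n%:R * sqnorm phi <= 1.
Proof.
have -> : n%:R * sqnorm phi = complex.Re (I s).
  by rewrite int_s /N cReM cRe_nat /= mul0r subr0 mulrC.
have cs : ccont s.
  apply: ccont_sum => i _; apply: ccontM => //; apply: ccontM; first exact: ccont_cst.
  by apply: ccont_sum => j _; apply: ccontM; [exact: ccontJ|exact: ccont_cst].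
rewrite -[leRHS](exp_cst mu) /=; apply: le_exp => //; last exact: bmf_cst.
by apply: bmf_continuous => //; case: cs.
Qed.

Lemma gram_dim_eq1 :
  (forall f, Hspace phi f -> exists c : 'I_n -> R[i], f = fun x => \sum_i c i * b i x) ->
  n%:R * sqnorm phi = 1.
Proof.
move=> span.
(* A spanning [b] makes [phi (x^-1 * _)] its own projection: its coordinates [d] solve the same Gram
   system as [c x]. Its value at the point [x] is [phi 1 = 1]. *)
have s1 x : s x = 1.
  have [d dE] := span _ (Hspace_translate phi x).
  have cx : ccont (fun y => phi (x^-1 * y)%g) by ccont_auto.
  have dG j : \sum_i d i * gram i j = N * (b j x)^*.
    have := Hspace_reproducing x sphi (bH j).
    rewrite (inner_conj cx (cb j)) => /(congr1 (fun z => z^*)).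
    rewrite cJK cJM /N cJ_real mulrC => <-.
    rewrite dE inner_suml//; apply: eq_bigr => i _; by rewrite mxE.
  have dc i : d i = c x i.
    have : (\row_k d k) *m gram = (\row_k c x k) *m gram.
      apply/rowP => j; rewrite !mxE; transitivity (N * (b j x)^*).
        by rewrite -dG; apply: eq_bigr => k _; rewrite mxE.
      by rewrite -cE; apply: eq_bigr => k _; rewrite mxE.
    move=> /(can_inj (mulmxK gram_unit)) /rowP /(_ i).
    by rewrite !mxE.
  rewrite /s -[RHS](spherical1 sphi) -(mulVg x) (congr1 (@^~ x) dE).
  by apply: eq_bigr => i _; rewrite dc.
have := int_s; rewrite (_ : s = cst 1) ?Cintegral_cst; last exact/funext.
move=> /(congr1 (@complex.Re R)).
by rewrite /N cReM cRe_nat /= mul0r subr0 mulrC.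
Qed.

End gram.

(** [dimH] takes the default 0 when no dimension exists, so existence has to be proved. Without it,
    every independent family misses an element of [Hspace phi] and can be enlarged, until
    [gram_dim_le1] is violated. *)
Lemma dimH_sqnorm phi : sph phi ->
  has_dim (Hspace phi) (dimH phi) /\ (dimH phi)%:R * sqnorm phi = 1.
Proof.
move=> sphi.
suff [n nP] : exists n, has_dim (Hspace phi) n.
  have h : has_dim (Hspace phi) (dimH phi) 
    by rewrite /dimH; apply: (@xgetPex _ 0%N [set m | has_dim (Hspace phi) m]); exists n.
  split=> //; case: h => b [bH ib span]; apply: (@gram_dim_eq1 _ b) => //.
  by move=> i; exact: Hspace_ccont (bH i).
apply: contrapT => noDim.
have ex n : exists b : 'I_n -> G -> R[i], (forall i, Hspace phi (b i)) /\ independent b.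
  elim: n => [|n [b [bH ib]]]; first by exists (fun=> phi); split=> [[]//|c _ []//].
  have [f fH nf] : exists2 f, Hspace phi f &
      ~ exists c : 'I_n -> R[i], f = fun x => \sum_(i < n) c i * b i x.
    apply: contrapT => H; apply: noDim; exists n, b; split=> // f fH.
    by apply: contrapT => nf; apply: H; exists f.
  exists (fun i => oapp b f (unlift ord0 i)); split=> [i|c c0].
    by case: unliftP => [j _|_] /=; [exact: bH|exact: fH].
  have E x : c ord0 * f x + \sum_(i < n) c (lift ord0 i) * b i x = 0.
    rewrite -[RHS](c0 x) big_ord_recl unlift_none; congr (_ + _).
    by apply: eq_bigr => i _; rewrite liftK.
  have c00 : c ord0 = 0.
    apply/eqP/negP => /negP n0; apply: nf; exists (fun i => - (c ord0)^-1 * c (lift ord0 i)).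
    apply/funext => x; apply: (mulfI n0); move/eqP: (E x); rewrite addr_eq0 => /eqP ->.
    by rewrite mulr_sumr -sumrN; apply: eq_bigr => i _; rewrite !mulrA mulrN mulfV// !mulN1r mulNr.
  move=> i; case: (unliftP ord0 i) => [j ->|-> //].
  apply: (ib (fun j => c (lift ord0 j))) => x.
  by rewrite -[RHS](E x) c00 mul0r add0r.
have N0 := sqnorm_gt0 sphi.
(* One more than the integer part of [1 / sqnorm phi]: too many vectors for [gram_dim_le1]. *)
pose n := (Num.truncn (sqnorm phi)^-1).+1.
have [b [bH ib]] := ex n.
have cb i : ccont (b i) by exact: Hspace_ccont (bH i).
have := gram_dim_le1 cb ib sphi bH; rewrite -ler_pdivlMr// div1r leNgt.
by rewrite truncnS_gt.
Qed.

(** * Finite expansions in spherical functions *)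

Lemma finite_rank_spherical phi : sph phi -> finite_rank phi.
Proof.
move=> sphi; have [[b [bH _ span]] _] := dimH_sqnorm sphi.
have /choice[c cE] z : exists c : 'I_(dimH phi) -> R[i],
    forall y, phi (z * y)%g = \sum_(i < dimH phi) c i * b i y.
  have [c cE] := span _ (Hspace_translate phi (z^-1)%g).
  by exists c => y; rewrite -(congr1 (@^~ y) cE) invgK.
exists 'I_(dimH phi), (fun i z => c z i), b; split=> // i.
exact: Hspace_ccont sphi (bH i).
Qed.

(** The coefficient of a left translate of [F] reproduces the values of [phi]. When [F] has finite
    rank and [inner F phi] is nonzero, [phi] is thereby a combination of the coefficient functions
    [c i]. *)
Lemma spherical_mul_inner phi F z : sph phi -> ccont F ->
  (forall k x, K k -> F (k * x)%g = F x) ->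
  phi z * inner F phi = inner (fun y => F (z * y)%g) phi.
Proof.
move=> sphi cF FK; have cp := spherical_ccont sphi.
have cpz : ccont (fun y => phi (z^-1 * y)%g) by ccont_auto.
have -> : phi z * inner F phi = (phi z^-1%g * inner phi F)^*.
  by rewrite cJM -(inner_conj)// (spherical_inv _ sphi) cJK.
rewrite -(inner_spherical_left)// -(inner_conj)//.
have cx : ccont (fun y => F y * (phi (z^-1 * y)%g)^*) by ccont_auto.
by rewrite /inner -(haarG_left z cx); apply: eq_Cintegral => y; rewrite mulKg.
Qed.

(** Every such [phi] lies in the span of the [#|J|] functions [c i], and distinct ones are
    orthogonal, so there are at most [#|J|] of them. *)
Lemma inner_neq0_finite F : ccont F -> (forall k x, K k -> F (k * x)%g = F x) ->
  finite_rank F -> finite_set [set phi | sph phi /\ inner F phi != 0].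
Proof.
move=> cF FK [J [c [v [cv FE]]]]; apply: contrapT => inf.
have [B BA Bn] := infinite_set_fset #|J|.+1 inf.
pose m := size (enum_fset B).
have mJ : (#|J| < m)%N by [].
pose phi (j : 'I_m) := nth (cst 1) (enum_fset B) j.
have phiB j : sph (phi j) /\ inner F (phi j) != 0 by apply: BA; exact: mem_nth.
have phi_inj (j k : 'I_m) : j != k -> phi j <> phi k.
  move=> jk /eqP; rewrite /phi nth_uniq ?fset_uniq// => /eqP/val_inj/eqP.
  by rewrite (negbTE jk).
have cphi j : ccont (phi j) by exact: (spherical_ccont (phiB j).1).
pose U : 'M[R[i]]_(m, #|J|) :=
  \matrix_(j, i) (inner (v (enum_val i)) (phi j) / inner F (phi j)).
have phiE j z : phi j z = \sum_i c (enum_val i) z * U j i.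
  apply: (mulIf (phiB j).2); rewrite spherical_mul_inner//; last exact: (phiB j).1.
  have -> : inner (fun y => F (z * y)%g) (phi j) = inner (fun y => \sum_i c i z * v i y) (phi j).
    by congr inner; apply/funext => y; rewrite FE.
  rewrite inner_suml// (reindex_onto enum_val enum_rank) => [|i _]; last exact: enum_rankK.
  rewrite mulr_suml; apply: eq_big => [i|i _]; first by rewrite enum_valK eqxx.
  by rewrite mxE mulrA divfK// (phiB j).2.
(* With more rows than columns [U] cannot be row free, yet orthogonality of the [phi j] forces it to
   be. *)
suff : row_free U by rewrite /row_free => /eqP rU; move: (rank_leq_col U); rewrite rU leqNgt mJ.
apply: inj_row_free => w wU.
pose f z := \sum_j w 0 j * phi j z.
have f0 z : f z = 0.
  rewrite /f; under eq_bigr do rewrite phiE mulr_sumr.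
  rewrite exchange_big big1// => i _.
  have /matrixP/(_ 0 i) := wU; rewrite !mxE => h.
  transitivity (c (enum_val i) z * \sum_j w 0 j * U j i); last by rewrite h mulr0.
  by rewrite mulr_sumr; apply: eq_bigr => j _; rewrite mulrCA.
apply/rowP => k; rewrite mxE; apply/eqP.
have : inner f (phi k) = 0.
  by rewrite -[RHS](Cintegral_cst mu); apply: eq_Cintegral => x; rewrite f0 mul0r.
rewrite /f inner_suml// (bigD1 k)//= big1 => [|j jk].
  rewrite addr0 inner_sqnorm => /eqP; rewrite mulf_eq0 => /orP[//|/eqP[/eqP]].
  by rewrite gt_eqF// (sqnorm_gt0 (phiB k).1).
by rewrite (spherical_orthogonal (phiB j).1 (phiB k).1 (phi_inj _ _ jk)) mulr0.
Qed.

Lemma L2_ccont f : ccont f -> (forall x k, K k -> f (x * k)%g = f x) -> L2 mu K f.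
Proof.
move=> cf fK; have [c1 c2] := cf; split=> //.
- by case: (bmf_continuous cG c1).
- by case: (bmf_continuous cG c2).
- have := bmf_integrable mu (bmf_continuous cG (ccont_normc cf)).
  by move=> /integrable_lty; exact.
Qed.

Hypothesis L2_sum : L2_sum_of_Hspaces mu nu K.

(** Translating [phi] only multiplies its inner product with [F] by a scalar, so [F] is orthogonal
    to every [Hspace phi]. An approximant [H] with squared error below [sqnorm F] itself then
    contradicts Pythagoras. *)
Lemma spherical_total F : ccont F -> (forall k x, K k -> F (k * x)%g = F x) ->
  (forall x k, K k -> F (x * k)%g = F x) ->
  (forall phi, sph phi -> inner F phi = 0) -> forall x, F x = 0.
Proof.
move=> cF FKl FKr F0; apply: (sqnorm_eq0 cF); apply/eqP.
rewrite eq_le sqnorm_ge0 andbT leNgt; apply/negP => Fp.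
have [n [phi [h [phih]]]] := L2_sum (L2_ccont cF FKr) Fp.
pose H x := \sum_(i < n) h i x.
have ch i : ccont (h i) by apply: Hspace_ccont (phih i).2; exact: (phih i).1.
have cH : ccont H by apply: ccont_sum.
have FH : inner F H = 0.
  have -> : inner F H = inner F (fun x => \sum_(i < n) 1 * h i x).
    by congr inner; apply/funext => x; apply: eq_bigr => i _; rewrite mul1r.
  rewrite inner_sumr// big1// => i _.
  have [spi [k [c [t ->]]]] := phih i.
  have cp := spherical_ccont spi.
  rewrite inner_sumr//; last by move=> j _; ccont_auto.
  rewrite big1 ?mulr0// => j _.
  rewrite (inner_conj)//; last by ccont_auto.
  by rewrite (inner_spherical_left)// (inner_conj)// F0// rmorph0 mulr0 rmorph0 mulr0.
have : sqnorm (fun x => F x - H x) = sqnorm F + sqnorm H.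
  have : inner (fun x => F x - H x) (fun x => F x - H x) = inner F F + inner H H.
    rewrite innerBl// ?innerBr//; try exact: ccontB.
    by rewrite (inner_conj cF cH) FH rmorph0; ring.
  by rewrite !inner_sqnorm -rmorphD => -[].
move=> E; have : sqnorm F <= sqnorm (fun x => F x - H x).
  by rewrite E lerDl sqnorm_ge0.
rewrite -lee_fin [X in (_ <= X)%E]fineK; last first.
  apply: integrable_fin_num => //; apply: bmf_integrable; apply: bmf_continuous => //.
  by apply: ccont_normc; exact: ccontB.
by move=> /le_lt_trans lt1 /lt1; rewrite ltxx.
Qed.

(** The factor [dimH phi] is the inverse of [sqnorm phi]. The remainder is continuous, bi-invariant
    and orthogonal to all spherical functions, so [spherical_total] makes the identity pointwise. *)
Lemma spherical_expansion F : ccont F -> (forall k x, K k -> F (k * x)%g = F x) ->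
  (forall x k, K k -> F (x * k)%g = F x) -> finite_rank F ->
  exists S : {fset (G -> R[i])},
    (forall phi, sph phi -> phi \notin S -> inner F phi = 0) /\
    (forall phi, phi \in S -> sph phi) /\
    forall x, F x = \sum_(phi <- enum_fset S) inner F phi * (dimH phi)%:R * phi x.
Proof.
move=> cF FKl FKr fF; have fin := inner_neq0_finite cF FKl fF.
pose S := fset_set [set phi | sph phi /\ inner F phi != 0].
have inS phi : (phi \in S) <-> (sph phi /\ inner F phi != 0).
  by rewrite in_fset_set//; split=> [/set_mem//|?]; exact/mem_set.
have notS phi : sph phi -> phi \notin S -> inner F phi = 0.
  by move=> sp nS; apply/eqP/negPn/negP => n0; move/negP: nS; apply; exact/inS.
exists S; split=> //; split=> [phi /inS[]//|x].
apply/eqP; rewrite -subr_eq0; apply/eqP.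
have cS phi : phi \in enum_fset S -> ccont phi by move=> /inS[/spherical_ccont].
move: x; apply: (@spherical_total (fun x => F x - \sum_(phi <- enum_fset S)
   inner F phi * (dimH phi)%:R * phi x)).
- apply: ccontB => //; rewrite (_ : (fun x => _) = fun x => \sum_(phi <- enum_fset S | phi \in enum_fset S)
    inner F phi * (dimH phi)%:R * phi x); last by apply/funext => x; rewrite big_seq.
  by apply: ccont_sum => phi /cS cp; apply: ccontM => //; exact: ccont_cst.
- move=> k x Kk; rewrite FKl// !big_seq; congr (_ - _); apply: eq_bigr => phi /inS[sp _].
  by rewrite (spherical_left _ sp Kk).
- move=> x k Kk; rewrite FKr// !big_seq; congr (_ - _); apply: eq_bigr => phi /inS[sp _].
  by rewrite (spherical_right _ sp Kk).
- move=> psi sp; have cp := spherical_ccont sp.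
  under [X in inner X _]eq_fun do rewrite big_seq.
  rewrite innerBl//; last by apply: ccont_sum => phi /cS cphi; apply: ccontM => //; exact: ccont_cst.
  rewrite inner_suml//.
  have orth phi : phi \in enum_fset S -> phi != psi ->
      inner F phi * (dimH phi)%:R * inner phi psi = 0.
    move=> pS /eqP npp.
    by rewrite (spherical_orthogonal ((inS _).1 pS).1 sp npp) mulr0.
  rewrite -big_seq; have [pS|nS] := boolP (psi \in enum_fset S).
    rewrite (bigD1_seq psi) ?fset_uniq//= big_seq_cond big1 => [|phi /andP[pS' npp]]; last exact: orth.
    have [_ d1] := dimH_sqnorm sp.
    rewrite addr0 inner_sqnorm -mulrA -(rmorph_nat (real_complex R)) -rmorphM/= d1.
    by rewrite mulr1 subrr.
  rewrite notS// big_seq big1 ?subrr// => phi pS; apply: orth => //.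
  by apply: contraNneq nS => <-.
Qed.

(** * The random walk *)

Lemma sqnorm_dimH phi : sph phi -> sqnorm phi = ((dimH phi)%:R)^-1.
Proof.
move=> sp; have [_ d1] := dimH_sqnorm sp.
have d0 : (dimH phi)%:R != 0 :> R.
  by apply/eqP => d0; move/eqP: d1; rewrite d0 mul0r eq_sym oner_eq0.
by apply: (mulfI d0); rewrite d1 mulfV.
Qed.

Lemma dimH_gt0 phi : sph phi -> 0 < (dimH phi)%:R :> R.
Proof. by move=> sp; rewrite -invr_gt0 -sqnorm_dimH// (sqnorm_gt0 sp). Qed.

Lemma parseval (S : seq (G -> R[i])) (x y : (G -> R[i]) -> R) (X Y : G -> R) :
  uniq S -> (forall phi, phi \in S -> sph phi) ->
  (forall g, (X g)%:C = \sum_(phi <- S) (x phi)%:C * phi g) ->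
  (forall g, (Y g)%:C = \sum_(phi <- S) (y phi)%:C * phi g) ->
  \int[mu]_g (X g * Y g) = \sum_(phi <- S) x phi * y phi / (dimH phi)%:R.
Proof.
move=> uS sS XE YE.
have cS phi : phi \in S -> ccont phi by move=> /sS/spherical_ccont.
have -> : \int[mu]_g (X g * Y g) = complex.Re (inner
   (fun g => \sum_(phi <- S | phi \in S) (x phi)%:C * phi g)
   (fun g => \sum_(phi <- S | phi \in S) (y phi)%:C * phi g)).
  apply: eq_Rintegral => g _; rewrite -!big_seq -XE -YE cJ_real.
  by rewrite cReM /= mul0r subr0.
rewrite inner_suml//; last first.
  by apply: ccont_sum => phi /cS cphi; apply: ccontM => //; exact: ccont_cst.
rewrite cRe_sum [RHS]big_seq; apply: eq_bigr => phi pS.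
have sp := sS _ pS; have cp := cS _ pS.
rewrite inner_sumr// -big_seq (bigD1_seq phi)//= big_seq_cond big1 => [|psi /andP[psS npp]].
  rewrite addr0 cJ_real inner_sqnorm sqnorm_dimH// !cReM /=.
  by rewrite !(mul0r, mulr0, subr0) mulrA.
have npp' : phi <> psi by move=> h; rewrite h eqxx in npp.
by rewrite (spherical_orthogonal sp (sS _ psS) npp') mulr0.
Qed.

Section walk.
Variable alpha : G.
Hypothesis alpha_sym : double_coset K alpha = double_coset K (alpha^-1)%g.

Lemma alphaV : exists k l, [/\ K k, K l & (alpha^-1)%g = (k * alpha * l)%g].
Proof.
suff : double_coset K alpha (alpha^-1)%g by [].
rewrite alpha_sym; exists 1%g, 1%g; rewrite mul1g mulg1.
by split=> //; exact: sK.1.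
Qed.

(** [alpha^-1] lies in the double coset of [alpha], so [phi] takes the same value at both, while
    [spherical_inv] makes these values conjugate. *)
Lemma spherical_alpha phi : sph phi -> phi alpha = (complex.Re (phi alpha))%:C.
Proof.
move=> sp; have : phi (alpha^-1)%g = phi alpha.
  have [k [l [Kk Kl ->]]] := alphaV.
  by rewrite (spherical_right _ sp Kl) (spherical_left _ sp Kk).
rewrite (spherical_inv _ sp) => E.
apply: complexP => //=; have := congr1 (@complex.Im R) E; rewrite cImJ; lra.
Qed.

Lemma spherical_regression phi (q : G -> R) : sph phi -> continuous q ->
  (forall x k, K k -> q (x * k)%g = q x) ->
  \int[mu]_g (complex.Re (phi (g * alpha)%g) * q g) =
  complex.Re (phi alpha) * \int[mu]_g (complex.Re (phi g) * q g).
Proof.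
move=> sp cq qK.
have := Cintegral_spherical_right alpha sp (ccont_real cq)
  (fun k x Kk => congr1 (real_complex R) (qK x k Kk)).
move=> /(congr1 (@complex.Re R)); rewrite spherical_alpha// cReM /= mul0r subr0 => E.
transitivity (complex.Re (I (fun y => phi (y * alpha)%g * (q y)%:C))).
  by apply: eq_Rintegral => g _; rewrite cReM /= mulr0 subr0.
rewrite [LHS]E; congr (_ * _); apply: eq_Rintegral => g _.
by rewrite cReM /= mulr0 subr0.
Qed.

Lemma walk_exchangeable (W : G -> R) (h1 h2 : R -> R) : continuous W ->
  (forall x k, K k -> W (x * k)%g = W x) -> continuous h1 -> continuous h2 ->
  \int[mu]_g (h1 (W (g * alpha)%g) * h2 (W g)) = \int[mu]_g (h1 (W g) * h2 (W (g * alpha)%g)).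
Proof.
move=> cW WK ch1 ch2.
have cc (u v : G -> G) : continuous u -> continuous v ->
   continuous (fun g => h1 (W (u g)) * h2 (W (v g))).
  move=> cu cv; have c1 : continuous (fun g => h1 (W (u g))).
    by apply: continuous_compf => //; exact: continuous_compf.
  have c2 : continuous (fun g => h2 (W (v g))).
    by apply: continuous_compf => //; exact: continuous_compf.
  by move=> g; apply: cvgM; [exact: c1|exact: c2].
have sGT : subgroup [set: G] by [].
have right a (F : G -> R) : continuous F -> \int[mu]_g F (g * a)%g = \int[mu]_g F g.
  by move=> cF; exact: (haar_right sc cG sGT measurableT hG cF).
have [k [l [Kk Kl aE]]] := alphaV.
(* Shifting by [alpha^-1 = k * alpha * l] turns the pair into [W g] and [W (g * k * alpha * l)];
   right invariance of [W] drops [l], and a shift by [k] matches the other side. *)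
rewrite -(right alpha^-1%g); last by apply: cc; group_continuous.
transitivity (\int[mu]_g (h1 (W (g * k^-1)%g) * h2 (W (g * alpha)%g))); last first.
  apply: eq_Rintegral => g _; rewrite WK//; exact: subgroupV.
rewrite -[RHS](right k); last by apply: cc; group_continuous.
apply: eq_Rintegral => g _; rewrite mulgVK mulgK aE.
by rewrite !mulgA (WK _ _ Kl).
Qed.

End walk.

(** * The statistic [W] and the spherical coefficients of its square *)

Variable tau : G -> R[i].
Hypothesis tau_spherical : spherical mu nu K tau.
Hypothesis tau_nonreal : ~ forall g, complex.Im (tau g) = 0.
Let d : R := (dimH tau)%:R.
Let F g := (tau g + (tau g)^*) ^+ 2.
Let W g := Num.sqrt (d / 2) * complex.Re (tau g + (tau g)^*).
Let m := multiplicity mu 2 tau.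
Let ct := spherical_ccont tau_spherical.

Let d0 : 0 < d. Proof. exact: (dimH_gt0 tau_spherical). Qed.

Let tE g : tau g + (tau g)^* = (2 * complex.Re (tau g))%:C.
Proof.
by apply: complexP; rewrite ?cReD ?cImD ?cReJ ?cImJ /= ?subrr// mulr_natl mulr2n.
Qed.

Let WE g : W g = Num.sqrt (d / 2) * 2 * complex.Re (tau g).
Proof. by rewrite /W tE mulrA. Qed.

Let FE g : F g = (4 * complex.Re (tau g) ^+ 2)%:C.
Proof. by rewrite /F tE -rmorphXn /= exprMn -natrX. Qed.

Let W2E g : (W g ^+ 2)%:C = (d / 2)%:C * F g.
Proof.
rewrite FE -rmorphM WE !exprMn sqr_sqrtr ?divr_ge0 ?ltW//; congr (_%:C); ring.
Qed.

Let cF : ccont F.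
Proof. by rewrite /F; ccont_auto. Qed.

Let cW : continuous W.
Proof.
rewrite (_ : W = fun g => Num.sqrt (d / 2) * 2 * complex.Re (tau g)); last exact/funext.
by move=> g; apply: cvgM; [exact: cvg_cst|exact: ct.1].
Qed.

Let Wright x k : K k -> W (x * k)%g = W x.
Proof. by move=> Kk; rewrite /W (spherical_right _ tau_spherical Kk). Qed.

Let Fright x k : K k -> F (x * k)%g = F x.
Proof. by move=> Kk; rewrite /F (spherical_right _ tau_spherical Kk). Qed.

Let Fleft k x : K k -> F (k * x)%g = F x.
Proof. by move=> Kk; rewrite /F (spherical_left _ tau_spherical Kk). Qed.

Let Frank : finite_rank F.
Proof.
have f1 := finite_rank_spherical tau_spherical.
by rewrite /F; apply: finite_rankM; apply: finite_rankD => //; exact: finite_rankJ.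
Qed.

(** Inversion preserves Haar measure and the real function [F], and conjugates [phi]. *)
Let inner_F_real phi : sph phi -> inner F phi = (complex.Re (inner F phi))%:C.
Proof.
move=> sp; have cp := spherical_ccont sp.
apply: complexP => //; suff : inner F phi = (inner F phi)^*.
  by move=> /(congr1 (@complex.Im R)); rewrite cImJ => h; rewrite [RHS]/=; lra.
rewrite -(inner_conj)// /inner -(haarG_inv); last by ccont_auto.
apply: eq_Cintegral => g.
rewrite (spherical_inv _ sp) cJK mulrC; congr (_ * _).
have -> : F (g^-1)%g = F g.
  by rewrite /F (spherical_inv _ tau_spherical) cJK addrC.
by rewrite FE cJ_real.
Qed.

Let mE phi : m phi ^+ 2 = (dimH phi)%:R * d ^+ 2 * complex.Re (inner F phi) ^+ 2.
Proof. by rewrite /m /multiplicity exprMn sqr_sqrtr// mulr_ge0// exprn_ge0// ltW. Qed.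

(** The coefficient of [phi] in the spherical expansion of [W ^+ 2]. *)
Let p phi : R := d / 2 * complex.Re (inner F phi) * (dimH phi)%:R.

Let pm phi : sph phi -> p phi ^+ 2 / (dimH phi)%:R = m phi ^+ 2 / 4.
Proof.
move=> sp; have := dimH_gt0 sp => h.
by rewrite mE /p; field; rewrite gt_eqF.
Qed.

(** Being non-real, [tau] differs from its conjugate, so the two are orthogonal; each has squared
    norm [1 / d]. *)
Let EW2 : \int[mu]_g (W g ^+ 2) = 1.
Proof.
pose tau' g := (tau g)^*.
have st' : sph tau' by exact: spherical_conj.
have ct' := spherical_ccont st'.
have ntt : tau <> tau'.
  move=> E; apply: tau_nonreal => g; have E' : tau g = (tau g)^* by exact: (congr1 (@^~ g) E).
  by have := congr1 (@complex.Im R) E'; rewrite cImJ; lra.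
have -> : \int[mu]_g (W g ^+ 2) = complex.Re (I (fun g => (d / 2)%:C * F g)).
  by apply: eq_Rintegral => g _; rewrite -W2E.
have -> : I (fun g => (d / 2)%:C * F g) = (d / 2)%:C *
   (inner tau tau' + inner tau tau + (inner tau' tau' + inner tau' tau)).
  rewrite (CintegralZ cG)//; congr (_ * _).
  rewrite /inner /tau' -!(CintegralD cG); try by ccont_auto.
  by apply: eq_Cintegral => g; rewrite /F cJK; ring.
rewrite (spherical_orthogonal tau_spherical st' ntt).
rewrite (spherical_orthogonal st' tau_spherical (nesym ntt)).
have -> : inner tau' tau' = inner tau tau.
  by apply: eq_Cintegral => g; rewrite /tau' cJK mulrC.
rewrite inner_sqnorm (sqnorm_dimH tau_spherical) -/d.
rewrite add0r addr0 cReM !cReD /= mul0r subr0.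
by field; rewrite gt_eqF.
Qed.

Variables (alpha : G) (a : R).
Hypothesis alpha_sym : double_coset K alpha = double_coset K (alpha^-1)%g.
Hypotheses (a_def : a%:C = 1 - tau alpha) (a_neq0 : a != 0).
Let c phi : R := 1 - complex.Re (phi alpha).

(** Only [a != 0] is assumed; the sign comes from [spherical_le1]. *)
Let a0 : 0 < a.
Proof.
rewrite lt_neqAle eq_sym a_neq0 /=.
have -> : a = complex.Re (1 - tau alpha) by rewrite -a_def.
by rewrite cReD cReN /= subr_ge0 (spherical_le1).
Qed.

Let tau_alpha : complex.Re (tau alpha) = 1 - a.
Proof.
have -> : a = complex.Re (1 - tau alpha) by rewrite -a_def.
by rewrite cReD cReN /=; ring.
Qed.

Let W' g := W (g * alpha)%g.

Let cW' : continuous W'.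
Proof. by apply: continuous_compf => //; group_continuous. Qed.

Let regression (q : G -> R) : continuous q -> (forall x k, K k -> q (x * k)%g = q x) ->
  \int[mu]_g (W' g * q g) = (1 - a) * \int[mu]_g (W g * q g).
Proof.
move=> cq qK; have cRe : continuous (fun g => complex.Re (tau g)) by case: ct.
have cRe' : continuous (fun g => complex.Re (tau (g * alpha)%g)).
  by apply: (continuous_compf cRe); group_continuous.
have bq := bmf_continuous cG cq.
have E (u : G -> R) : continuous u ->
  \int[mu]_g (Num.sqrt (d / 2) * 2 * u g * q g) = Num.sqrt (d / 2) * 2 * \int[mu]_g (u g * q g).
  move=> cu; have bu := bmf_continuous cG cu.
  rewrite -expZ; last exact: bmfM.
  by apply: eq_Rintegral => g _; rewrite -mulrA.
under eq_Rintegral do rewrite /W' WE.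
under [in RHS]eq_Rintegral do rewrite WE.
rewrite (E (fun g => complex.Re (tau (g * alpha)%g)))// (E (fun g => complex.Re (tau g)))//.
rewrite (spherical_regression alpha_sym tau_spherical cq qK) tau_alpha.
by rewrite mulrCA.
Qed.

Lemma stein_spherical (x0 : R) :
  `| fine (mu [set g | W g <= x0]) - gauss_cdf x0 |
  <= 2^-1 * Num.sqrt (\sum_(phi \in [set phi | sph phi /\ phi <> cst 1])
          m phi ^+ 2 * (2 - a^-1 * c phi) ^+ 2)
     + (pi^-1 * \sum_(phi \in [set phi | sph phi])
          m phi ^+ 2 * (2 - 3 / (2 * a) * c phi)) `^ 4^-1.
Proof.
have [S [Sout [Ssph SE]]] := spherical_expansion cF Fleft Fright Frank.
pose s := enum_fset S.
have us : uniq s by exact: fset_uniq.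
have ssph phi : phi \in s -> sph phi by exact: Ssph.
have mout phi : sph phi -> phi \notin s -> m phi = 0.
  by move=> sp /(Sout _ sp) h; apply/eqP; rewrite -sqrf_eq0 mE h /= expr0n mulr0.
have W2s g : (W g ^+ 2)%:C = \sum_(phi <- s) (p phi)%:C * phi g.
  rewrite W2E SE mulr_sumr !big_seq; apply: eq_bigr => phi pS.
  rewrite (inner_F_real (ssph _ pS)) /p -(rmorph_nat (real_complex R)) -!rmorphM /= mulrA.
  by rewrite -!rmorphM /= mulrA.
pose l phi : R := complex.Re (phi alpha).
(* The conditional expectation of [W' ^+ 2] given [g]: a step of the walk multiplies the coefficient
   of [phi] by [phi alpha]. *)
pose T2 g : R := \sum_(phi <- s) p phi * l phi * complex.Re (phi g).
have cs phi : phi \in s -> ccont phi by move=> /ssph/spherical_ccont.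
have T2s g : (T2 g)%:C = \sum_(phi <- s) (p phi * l phi)%:C * phi g.
  apply: complexP.
    rewrite cRe_sum [LHS]/=; apply: eq_bigr => phi _.
    by rewrite cReM /= mul0r subr0.
  rewrite [LHS]/=.
  (* The sum is real because it is the average over [K] of the real numbers
     [W (g * k * alpha) ^+ 2]. *)
  have -> : \sum_(phi <- s) (p phi * l phi)%:C * phi g =
      Cintegral nu setT (fun k => (W (g * k * alpha)%g ^+ 2)%:C).
    transitivity (Cintegral nu setT
        (fun k => \sum_(phi <- s | phi \in s) (p phi)%:C * phi (g * k * alpha)%g)).
      rewrite (Cintegral_sum cG) => [|phi /cs cp]; last by ccont_auto.
      rewrite big_seq; apply: eq_bigr => phi ps; have cp := cs _ ps.
      rewrite (CintegralZ cG); last by ccont_auto.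
      rewrite (spherical_eq _ _ (ssph _ ps)) rmorphM /= -mulrA.
      by rewrite (spherical_alpha alpha_sym (ssph _ ps)) [phi g * _]mulrC.
    by apply: eq_Cintegral => k; rewrite W2s [RHS]big_seq.
  by apply/esym; rewrite -[RHS](exp_cst nu 0).
have cT2 : continuous T2.
  have [+ _] : ccont (fun g => \sum_(phi <- s | phi \in s) (p phi * l phi)%:C * phi g).
    by apply: ccont_sum => phi /cs cp; ccont_auto.
  by under eq_fun do rewrite -big_seq -T2s.
have square (q : G -> R) : continuous q -> (forall x k, K k -> q (x * k)%g = q x) ->
    \int[mu]_g (W' g ^+ 2 * q g) = \int[mu]_g (T2 g * q g).
  move=> cq qK; have bq := bmf_continuous cG cq.
  have bRe phi : phi \in s -> bmf (fun g : borel G => complex.Re (phi g)).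
    by move=> /cs[c1 _]; exact: bmf_continuous.
  have bRe' phi : phi \in s -> bmf (fun g : borel G => complex.Re (phi (g * alpha)%g)).
    move=> /cs[c1 _]; apply: bmf_continuous => //.
    by apply: (continuous_compf c1); group_continuous.
  transitivity (\int[mu]_g (\sum_(phi <- s | phi \in s)
      p phi * (complex.Re (phi (g * alpha)%g) * q g))).
    apply: eq_Rintegral => g _; have := congr1 (@complex.Re R) (W2s (g * alpha)%g).
    rewrite [LHS]/= cRe_sum => ->; rewrite -big_seq mulr_suml; apply: eq_bigr => phi _.
    by rewrite cReM /= mul0r subr0 mulrA.
  transitivity (\int[mu]_g (\sum_(phi <- s | phi \in s)
      p phi * l phi * (complex.Re (phi g) * q g))); last first.
    apply: eq_Rintegral => g _; rewrite -big_seq mulr_suml; apply: eq_bigr => phi _.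
    by rewrite mulrA.
  rewrite !exp_sum; last 2 first.
    by move=> phi /bRe br; apply: bmfM; [exact: bmf_cst|exact: bmfM].
    by move=> phi /bRe' br; apply: bmfM; [exact: bmf_cst|exact: bmfM].
  apply: eq_bigr => phi ps; have b1 := bmfM (bRe _ ps) bq; have b2 := bmfM (bRe' _ ps) bq.
  rewrite !expZ//.
  by rewrite -mulrA -(spherical_regression alpha_sym (ssph _ ps) cq qK).
have bW := bmf_continuous cG cW; have bW' := bmf_continuous cG cW'.
have bT2 := bmf_continuous cG cT2.
(* The conditional expectation of [(W' - W) ^+ 2], assembled from that of [W' ^+ 2] and the
   regression value [(1 - a) * W] of [W']. *)
pose T g := T2 g - 2 * (1 - a) * W g ^+ 2 + W g ^+ 2.
have bT : bmf (T : borel G -> R) by rewrite /T; bmf_auto.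
have exch := walk_exchangeable alpha_sym cW Wright.
have cid : continuous (fun x : R => x) by move=> x; exact: cvg_id.
have cst1 : continuous (fun _ : R => 1 : R) by move=> x; exact: cvg_cst.
have cpow n : continuous (fun x : R => x ^+ n) by exact: exprn_continuous.
have same (h : R -> R) : continuous h -> \int[mu]_g h (W' g) = \int[mu]_g h (W g).
  move=> ch; have := exch h _ ch cst1.
  by under eq_Rintegral do rewrite mulr1; under [in RHS]eq_Rintegral do rewrite mulr1.
have antisym (f : R -> R) : continuous f ->
    \int[mu]_g ((W' g - W g) * (f (W' g) + f (W g))) = 0.
  move=> cf; have := exch _ _ cid cf; rewrite -/W' => E.
  have cxf : continuous (fun x : R => x * f x) by move=> x; apply: cvgM; [exact: cid|exact: cf].
  have E' := same _ cxf.
  transitivity (\int[mu]_g ((W' g * f (W' g) - W g * f (W g)) + (W' g * f (W g) - W g * f (W' g)))).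
    by apply: eq_Rintegral => g _; ring.
  rewrite expD; try by bmf_auto.
  rewrite !expB; try by bmf_auto.
  by rewrite E E' !subrr addr0.
have regr (f : R -> R) : continuous f ->
    \int[mu]_g (W' g * f (W g)) = (1 - a) * \int[mu]_g (W g * f (W g)).
  move=> cf; apply: (@regression (fun g => f (W g))); first exact: continuous_compf.
  by move=> x k Kk; rewrite Wright.
have condsq (f : R -> R) : continuous f ->
    \int[mu]_g ((W' g - W g) ^+ 2 * f (W g)) = \int[mu]_g (T g * f (W g)).
  move=> cf; have cxf : continuous (fun x : R => x * f x).
    by move=> x; apply: cvgM; [exact: cid|exact: cf].
  have cfW : continuous (fun g => f (W g)) by exact: continuous_compf.
  have sq := square _ cfW (fun x k Kk => congr1 f (Wright x Kk)).
  transitivity (\int[mu]_g (W' g ^+ 2 * f (W g) - 2 * (W' g * (W g * f (W g)))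
      + W g ^+ 2 * f (W g))).
    by apply: eq_Rintegral => g _; ring.
  transitivity (\int[mu]_g (T2 g * f (W g) - 2 * (1 - a) * (W g * (W g * f (W g)))
      + W g ^+ 2 * f (W g))); last by apply: eq_Rintegral => g _; rewrite /T; ring.
  rewrite !expD; try by bmf_auto.
  rewrite !expN; try by bmf_auto.
  rewrite !expZ; try by bmf_auto.
  by rewrite sq (regr _ cxf) mulrA.
have := @stein_exchangeable_bound _ _ _ mu W W' T a bW bW' bT a0 antisym regr condsq x0.
move/le_trans; apply; apply: lerD.
(* The trivial function has coefficient [E W^2 = 1], which cancels the constant in
   [1 - T / (2 * a)]; hence its absence from the first sum. *)
- have p1 : p (cst 1) = 1.
    have s1 : sph (cst 1) := spherical_cst1.
    have d1 : (dimH (cst 1 : G -> R[i]))%:R = 1 :> R.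
      rewrite -[LHS]invrK -(sqnorm_dimH s1) /sqnorm.
      rewrite -[RHS]invr1 -(exp_cst mu 1); congr (_^-1); apply: eq_Rintegral => g _.
      by rewrite sqr_normc_Re_Im /= expr1n expr0n addr0.
    rewrite /p d1 mulr1 -[RHS]EW2; have bF : bmf (fun g : borel G => complex.Re (F g)).
      by apply: bmf_continuous => //; exact: cF.1.
    have -> : complex.Re (inner F (cst 1)) = \int[mu]_g complex.Re (F g).
      by apply: eq_Rintegral => g _; rewrite rmorph1 mulr1.
    rewrite -expZ//; apply: eq_Rintegral => g _.
    by rewrite -[RHS]/(complex.Re (W g ^+ 2)%:C) W2E cReZ.
  have cst1s : cst 1 \in s.
    apply: contraT => ns; have h := Sout _ (spherical_cst1) ns.
    by move/eqP: p1; rewrite /p h mulr0 mul0r eq_sym oner_eq0.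
  (* [T] has coefficients [p phi * (2 * a - c phi)], because [1 - 2 * (1 - a) = 2 * a - 1] and
     [l phi = 1 - c phi]. *)
  pose x phi : R := (phi == cst 1)%:R - p phi * (1 - c phi / (2 * a)).
  have XE g : (1 - T g / (2 * a))%:C = \sum_(phi <- s) (x phi)%:C * phi g.
    have -> : \sum_(phi <- s) (x phi)%:C * phi g =
      \sum_(phi <- s) ((phi == cst 1)%:R%:C * phi g) -
      (2 * a)^-1%:C * (\sum_(phi <- s) (p phi * l phi)%:C * phi g +
        (2 * a - 1)%:C * \sum_(phi <- s) (p phi)%:C * phi g).
      rewrite !mulr_sumr -big_split /= mulr_sumr -sumrB; apply: eq_bigr => phi _.
      have -> : x phi = (phi == cst 1)%:R - (2 * a)^-1 * (p phi * l phi + (2 * a - 1) * p phi).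
        by rewrite /x /c -/(l phi); field.
      by rewrite rmorphB rmorphM rmorphD !rmorphM /=; ring.
    rewrite (bigD1_seq (cst 1))//= eqxx big1 => [|phi /negbTE ->]; last by rewrite mul0r.
    rewrite addr0 -T2s -W2s.
    have -> : 1 - T g / (2 * a) = 1 - (2 * a)^-1 * (T2 g + (2 * a - 1) * W g ^+ 2).
      by rewrite /T; field.
    rewrite rmorphB rmorphM rmorphD rmorphM; congr (_ - _).
    by rewrite mulr1.
  have -> : \int[mu]_g (1 - T g / (2 * a)) ^+ 2 =
      4^-1 ^+ 2 * \sum_(phi <- s | phi != cst 1) m phi ^+ 2 * (2 - a^-1 * c phi) ^+ 2.
    rewrite (parseval us ssph XE XE) (bigD1_seq (cst 1))//=.
    rewrite {1 2}/x eqxx p1 /c /= subrr mul0r subr0 mulr1 subrr !mul0r add0r.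
    rewrite mulr_sumr big_seq_cond [RHS]big_seq_cond; apply: eq_bigr => phi /andP[ps /negbTE np].
    have -> : x phi * x phi / (dimH phi)%:R =
        p phi ^+ 2 / (dimH phi)%:R * (1 - c phi / (2 * a)) ^+ 2.
      by rewrite /x np sub0r; ring.
    by rewrite (pm (ssph _ ps)) /c; field.
  rewrite sqrtrM ?sqr_ge0// sqrtr_sqr ger0_norm ?invr_ge0//.
  (* A sum with infinite support would be 0 by convention; since [m] vanishes on spherical functions
     outside [s], the sum in the statement is a genuine finite one. *)
  rewrite (fsbigE [seq phi <- s | phi != cst 1]).
  + have -> : \sum_(phi <- [seq phi <- s | phi != cst 1] | phi \in [set phi | sph phi /\ phi <> cst 1])
        m phi ^+ 2 * (2 - a^-1 * c phi) ^+ 2 =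
      \sum_(phi <- s | phi != cst 1) m phi ^+ 2 * (2 - a^-1 * c phi) ^+ 2.
      rewrite big_filter_cond big_seq_cond [RHS]big_seq_cond; apply: eq_bigl => phi.
      case: (boolP (phi \in s)) => //= ps; case: eqVneq => //= np.
      by apply/mem_set; split; [exact: ssph|exact/eqP].
    (* The argument yields the factor 1/4 in front of the root; the stated 1/2 is weaker. *)
    by rewrite ler_wpM2r ?sqrtr_ge0//; lra.
  + exact: filter_uniq.
  + by move=> phi; rewrite /= mem_filter => /andP[/eqP np ps]; split=> //; exact: ssph.
  + move=> phi [sp np]; rewrite mem_filter negb_and => /orP[/negPn/eqP//|ns].
    by rewrite mout// expr0n mul0r.
- set B3 := \int[mu]_g _ ^+ 3.
  have E4 : \int[mu]_g (W g ^+ 4) = \sum_(phi <- s) p phi * p phi / (dimH phi)%:R.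
    rewrite -(parseval us ssph W2s W2s).
    by apply: eq_Rintegral => g _; ring.
  have E22 : \int[mu]_g (W' g ^+ 2 * W g ^+ 2) =
      \sum_(phi <- s) p phi * l phi * p phi / (dimH phi)%:R.
    rewrite -(parseval us ssph T2s W2s); apply: square.
      exact: (continuous_compf (cpow 2%N)).
    by move=> x k Kk; rewrite Wright.
  have B2 : \int[mu]_g (W' g - W g) ^+ 2 = 2 * a.
    transitivity (\int[mu]_g ((W' g ^+ 2 - 2 * (W' g * W g)) + W g ^+ 2)).
      by apply: eq_Rintegral => g _; ring.
    rewrite expD; try by bmf_auto.
    rewrite expB; try by bmf_auto.
    rewrite expZ; try by bmf_auto.
    rewrite (same _ (cpow 2%N)) EW2 (regr _ cid).
    have -> : \int[mu]_g (W g * W g) = 1 by rewrite -EW2; apply: eq_Rintegral => g _; ring.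
    by ring.
  pose S2 := \sum_(phi <- s) m phi ^+ 2 * (2 - 3 / (2 * a) * c phi).
  (* Exchangeability reduces the expansion to [2 E W^4 - 8 E W' W^3 + 6 E W'^2 W^2]; regression and
     [E22] evaluate it. Each [m phi ^+ 2] is 4 times [p phi ^+ 2 / dimH phi]. *)
  have B4 : \int[mu]_g (W' g - W g) ^+ 4 = a * S2.
    transitivity (\int[mu]_g ((((W' g ^+ 4 - 4 * (W' g ^+ 3 * W g)) + 6 * (W' g ^+ 2 * W g ^+ 2))
       - 4 * (W' g * W g ^+ 3)) + W g ^+ 4)).
      by apply: eq_Rintegral => g _; ring.
    rewrite expD; try by bmf_auto.
    rewrite expB; try by bmf_auto.
    rewrite expD; try by bmf_auto.
    rewrite expB; try by bmf_auto.
    rewrite !expZ; try by bmf_auto.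
    rewrite (same _ (cpow 4%N)) (exch _ _ (cpow 3%N) cid).
    have -> : \int[mu]_g (W g ^+ 3 * W (g * alpha)%g) = \int[mu]_g (W' g * W g ^+ 3).
      by apply: eq_Rintegral => g _; rewrite mulrC.
    rewrite (regr _ (cpow 3%N)) E22.
    have -> : \int[mu]_g (W g * W g ^+ 3) = \int[mu]_g (W g ^+ 4).
      by apply: eq_Rintegral => g _; ring.
    rewrite E4; set e := \sum_(phi <- s) _; set e' := \sum_(phi <- s) _.
    have -> : a * S2 = 8 * a * e - 6 * (e - e').
      rewrite /S2 /e /e' -sumrB !mulr_sumr -sumrB big_seq [RHS]big_seq.
      apply: eq_bigr => phi ps; have d1 := dimH_gt0 (ssph _ ps).
      have -> : m phi ^+ 2 = 4 * (p phi ^+ 2 / (dimH phi)%:R).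
        by rewrite (pm (ssph _ ps)); field.
      by rewrite /c -/(l phi); field; rewrite gt_eqF.
    by ring.
  have S20 : 0 <= S2.
    rewrite -(pmulr_rge0 _ a0) -B4; apply: exp_ge0 => g.
    by rewrite (_ : 4 = 2 * 2)%N // exprM sqr_ge0.
  have B30 : 0 <= B3 by apply: exp_ge0 => g; exact: exprn_ge0.
  (* Cauchy-Schwarz for [|W' - W|] and [(W' - W) ^+ 2] bounds the third moment by the second and the
     fourth. *)
  have B3le : B3 ^+ 2 <= 2 * a * (a * S2).
    rewrite -B2 -B4.
    have bD : bmf (fun g : borel G => W' g - W g) by bmf_auto.
    have := exp_cauchy_schwarz mu (bmf_norm bD) (bmfX 2 bD).
    congr (_ ^+ 2 <= _ * _); apply: eq_Rintegral => g _.
    - by rewrite -[X in _ * X]real_normK ?num_real// -exprS.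
    - by rewrite real_normK ?num_real.
    - by rewrite -exprM.
  rewrite (fsbigE s)//; last first.
    by move=> phi sp ns; rewrite mout// expr0n mul0r.
  have -> : \sum_(phi <- s | phi \in [set phi | sph phi]) m phi ^+ 2 *
      (2 - 3 / (2 * a) * c phi) = S2.
    rewrite /S2 big_seq_cond [RHS]big_seq; apply: eq_bigl => phi.
    by case: (boolP (phi \in s)) => //= ps; apply/mem_set/ssph.
  have pi0 := pi_gt0 R; have sp0 := @sqrt2pi_gt0 R.
  apply: ler_powR4.
  + by rewrite mulr_ge0// sqrtr_ge0.
  + by rewrite mulr_ge0// invr_ge0 ltW.
  (* Since [z] is [B3 / (4 * a * sqrt (2 * pi))], [16 * z ^+ 2] is [B3 ^+ 2 / (2 * pi * a ^+ 2)], at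
     most [S2 / pi] by [B3le]. *)
  set z := _^-1 * (B3 / (2 * a)).
  have z0 : 0 <= z.
    by rewrite /z mulr_ge0 ?divr_ge0 ?invr_ge0 ?mulr_ge0// ltW.
  have -> : (2 * Num.sqrt z) ^+ 4 = 16 * z ^+ 2.
    by rewrite -[z in RHS]sqr_sqrtr//; ring.
  have -> : 16 * z ^+ 2 = B3 ^+ 2 / (Num.sqrt (2 * pi) ^+ 2 * a ^+ 2).
    by rewrite /z; field; rewrite a_neq0 gt_eqF.
  rewrite sqr_sqrtr; last by rewrite mulr_ge0// ltW.
  rewrite ler_pdivrMr; last by rewrite !mulr_gt0// exprn_gt0.
  have E (q : R) : q != 0 -> q^-1 * S2 * (2 * q * a ^+ 2) = 2 * a * (a * S2).
    by move=> q0; field.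
  by rewrite E ?gt_eqF.
Qed.

End spherical_functions.

Theorem theorem4p15 (R : realType) (G : topologicalGroupType) (K : set G)
    (GK : compact_symmetric_space R K)
    (mu nu : probability (borel G) R)
    (haarG : haar_on [set: G] mu) (haarK : haar_on K nu)
    (L2_sum : L2_sum_of_Hspaces mu nu K)
    (tau : G -> R[i]) (tau_spherical : spherical mu nu K tau)
    (tau_nonreal : ~ forall g, complex.Im (tau g) = 0)
    (alpha : G) (alpha_notin : ~ K alpha)
    (alpha_sym : double_coset K alpha = double_coset K (alpha^-1)%g)
    (a : R) (a_def : a%:C = 1 - tau alpha) (a_neq0 : a != 0)
    (x0 : R) :
  let W : G -> R := fun g =>
    Num.sqrt ((dimH tau)%:R / 2) * complex.Re (tau g + (tau g)^*) in
  let m : (G -> R[i]) -> R := multiplicity mu 2 tau in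
  let c : (G -> R[i]) -> R := fun phi => 1 - complex.Re (phi alpha) in
  `| fine (mu [set g | W g <= x0])
     - (Num.sqrt (2 * pi))^-1 *
       \int[lebesgue_measure]_(x in `]-oo, x0]) expR (- (x ^+ 2 / 2)) |
  <= 2^-1 * Num.sqrt
       (\sum_(phi \in [set phi | spherical mu nu K phi /\ phi <> cst 1])
          m phi ^+ 2 * (2 - a^-1 * c phi) ^+ 2)
     + (pi^-1 *
        \sum_(phi \in [set phi | spherical mu nu K phi])
          m phi ^+ 2 * (2 - 3 / (2 * a) * c phi)) `^ 4^-1.
Proof.
have [[hausG sc _ _ _] _ _] := css_lie GK.
have mK : measurable (K : set (borel G)).
  rewrite -[K]setCK; apply: measurableC; apply: sub_sigma_algebra.
  by apply: closed_openC; exact: compact_closed hausG (css_K_compact GK).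
cbv zeta; rewrite -gauss_cdf_expR.
exact: (stein_spherical sc (css_compact GK) (css_K_subgroup GK) mK haarG haarK
  L2_sum tau_spherical tau_nonreal alpha_sym a_def a_neq0 x0).
Qed.
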